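(* Let $\Delta>0$, $\mathcal{H}_\Delta=\{\mu\in\mathbb{R}^2:|\mu_1-\mu_2|=\Delta\}$, $\mu\in\mathcal{H}_\Delta$, let $T\ge1$ be an integer, and let $\epsilon_T = \frac{\Delta}{4} \left(\log(e + T\Delta^2)\right)^{-1/8}$. If $T(2\Delta-3\epsilon_T)^2 \geq 2$ and $T\epsilon_T^2 \geq e^2$, the regret of the $\Delta$-UCB algorithm (run with inputs $T$ and $\Delta$) is upper bounded as $$R_\mu^{\Delta\text{-}\mathrm{UCB}}(T) \leq \frac{\log\left(2T\Delta^2\right)}{2\Delta\left(1 - \frac{3\epsilon_T}{2\Delta}\right)^2} + \frac{\sqrt{\pi\log\left(2T\Delta^2\right)}}{2\Delta\left(1 - \frac{3\epsilon_T}{\Delta}\right)^2} + \Delta\left[\frac{30e \sqrt{\log(\epsilon^2_T T)}}{\epsilon_T^2} + \frac{80}{\epsilon_T^2}+ \frac{2}{(2\Delta - 3\epsilon_T)^2}\right] + 5\Delta .$$ Moreover, $\limsup_{T\to\infty} R_\mu^{\Delta\text{-}\mathrm{UCB}}(T) / \log(T) \leq (2\Delta)^{-1}$, and for all $\mu \in \mathcal H_\Delta$, $R_\mu^{\Delta\text{-}\mathrm{UCB}}(T) \leq 328\sqrt{T} + 5\Delta$.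
   Context: Two-armed Gaussian bandit with known integer horizon $T$: at each time $t\in\{1,\dots,T\}$ the agent chooses $A_t\in\{1,2\}$ based on past observations and receives a reward $Z_t\sim\mathcal N(\mu_{A_t},1)$, where successive rewards from each arm are i.i.d. and the two arms are independent. Expectation under $\mu=(\mu_1,\mu_2)$ is denoted $\mathbb{E}_\mu$. The regret of a strategy $\pi$ is $R^\pi_\mu(T) = T \max\{\mu_1, \mu_2\} - \mathbb{E}_\mu\left[\sum_{t=1}^T \mu_{A_t}\right]$. $N_i(t)=\sum_{s=1}^t\mathbf{1}\{A_s=i\}$ is the number of draws of arm $i$ up to time $t$, and $\hat\mu_i(t)$ is the empirical mean of the rewards obtained from arm $i$ up to time $t$. $\Delta$-UCB algorithm (inputs $T$ and $\Delta$): set $\epsilon_T = \frac{\Delta}{4}(\log(e + T\Delta^2))^{-1/8}$. At each $t\in\{1,\dots,T\}$ let $A_{t,\min} = \operatorname{argmin}_{i\in\{1,2\}} N_i(t-1)$ (ties broken arbitrarily) and $A_{t,\max}=3-A_{t,\min}$. If $$\hat \mu_{A_{t,\min}}(t-1) + \sqrt{\frac{2 \log\left(T/N_{A_{t,\min}}(t-1)\right)}{N_{A_{t,\min}}(t-1)}} \geq \hat \mu_{A_{t,\max}}(t-1) + \Delta - 2\epsilon_T$$ then choose $A_t=A_{t,\min}$, otherwise choose $A_t=A_{t,\max}$. By convention the condition is considered satisfied (the left-hand side is $+\infty$) when $N_{A_{t,\min}}(t-1)=0$. *)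

(* Defs.v *)
From HB Require Import structures.
From mathcomp Require Import all_boot all_order all_algebra.
From mathcomp Require Import all_classical all_reals all_analysis.

Set Implicit Arguments.
Unset Strict Implicit.
Unset Printing Implicit Defensive.

Import Order.TTheory GRing.Theory Num.Theory.
Import numFieldNormedType.Exports.

Local Open Scope classical_set_scope.
Local Open Scope ring_scope.

(* The two arms are [false] (arm 1) and [true] (arm 2), so that [~~ i] is the
   arm other than [i] and a mean vector [mu] in R^2 is a function on [bool]. *)
Notation arm := bool.

Definition hyp_gap (R : realType) (Delta : R) : set (arm -> R) :=
  [set mu | `|mu false - mu true| = Delta].

(* The observations [:: (A_1, Z_1); ...; (A_n, Z_n)] in chronological order.
   At round t = n + 1 the agent sees a history of size n. *)
Definition history (R : realType) := seq (arm * R).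

Definition strategy (R : realType) := history R -> arm.

Definition measurable_strategy (R : realType) (pi : strategy R) : Prop :=
  forall n : nat,
    measurable_fun setT (fun h : n.-tuple (arm * R) => pi (tval h)).

Definition draws (R : realType) (h : history R) (i : arm) : nat :=
  count (fun az : arm * R => az.1 == i) h.

Definition emp_mean (R : realType) (h : history R) (i : arm) : R :=
  (\sum_(az <- h | az.1 == i) az.2) / (draws h i)%:R.

Section Bandit.
Context {R : realType} {d : measure_display} {Omega : measurableType d}.
Variable P : probability Omega R.

Definition mutually_independent (I : choiceType) (X : I -> {RV P >-> R}) :
    Prop :=
  forall (J : seq I) (B : I -> set R), uniq J ->
    (forall j, measurable (B j)) ->
    P (\bigcap_(j in [set` J]) (X j @^-1` B j)) =
      (\big[*%E/1%E]_(j <- J) P (X j @^-1` B j))%E.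

(* [X i k] is the (k+1)-th reward delivered by arm [i]; the second parameter
   of [normal_prob] is the standard deviation. *)
Definition gaussian_bandit (mu : arm -> R) (X : arm -> nat -> {RV P >-> R}) :
    Prop :=
  (forall i k (B : set R), measurable B ->
     distribution P (X i k) B = normal_prob (mu i) 1 B) /\
  mutually_independent (fun ik : arm * nat => X ik.1 ik.2).

(* The history after [t] rounds of [pi]: when arm [i] is chosen, the next
   unused reward of [i] is received. *)
Fixpoint play (X : arm -> nat -> {RV P >-> R}) (pi : strategy R) (t : nat)
    (w : Omega) : history R :=
  if t is t'.+1 then
    let h := play X pi t' w in
    let i := pi h in
    rcons h (i, X i (draws h i) w)
  else [::].

(* The arm A_t, meaningful for [1 <= t]. *)
Definition chosen_arm (X : arm -> nat -> {RV P >-> R}) (pi : strategy R)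
    (t : nat) (w : Omega) : arm :=
  pi (play X pi t.-1 w).

Definition regret (mu : arm -> R) (X : arm -> nat -> {RV P >-> R})
    (pi : strategy R) (T : nat) : \bar R :=
  ((T%:R * Num.max (mu false) (mu true))%:E
   - 'E_P[(fun w => (\sum_(1 <= t < T.+1) mu (chosen_arm X pi t w))%R)])%E.

End Bandit.

Definition eps_ (R : realType) (Delta : R) (T : nat) : R :=
  Delta / 4 * (ln (expR 1 + T%:R * Delta ^+ 2)) `^ (- (1 / 8)).

(* [tie] selects the least drawn arm when both arms were drawn equally often. *)
Definition argmin_draws (R : realType) (tie : history R -> arm)
    (h : history R) : arm :=
  if (draws h false < draws h true)%N then false
  else if (draws h true < draws h false)%N then true
  else tie h.

Definition delta_ucb (R : realType) (T : nat) (Delta : R)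
    (tie : history R -> arm) : strategy R :=
  fun h =>
    let a := argmin_draws tie h in
    let N : R := (draws h a)%:R in
    if (draws h a == 0%N)
       || (emp_mean h (~~ a) + Delta - 2 * eps_ Delta T
             <= emp_mean h a + Num.sqrt (2 * ln (T%:R / N) / N))
    then a else ~~ a.

(* Main.v *)
Require Import Defs.
From HB Require Import structures.
From mathcomp Require Import all_boot all_order all_algebra.
From mathcomp Require Import all_classical all_reals all_analysis.
From mathcomp Require Import measurable_realfun.
From mathcomp Require Import ring lra.

Set Implicit Arguments.
Unset Strict Implicit.
Unset Printing Implicit Defensive.

Import Order.TTheory GRing.Theory Num.Theory.
Import numFieldNormedType.Exports.

Local Open Scope classical_set_scope.
Local Open Scope ring_scope.

(** The regret is [Delta] times the expected number of draws of the worse arm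
    [b]. Write [W i n] for the sum of the first [n] rewards of arm [i], each
    minus its mean, and [eps] for the slack [eps_ Delta T].

    A draw of [b] that follows [s >= 1] earlier draws of [b] betrays one of
    four deviations ([bad_draw_cases]):
    - the mean of the best arm after some [n >= s] draws is too low by [eps];
    - the index of [b] is too high: [2 Delta - 3 eps] is at most
      [W b s / s + sqrt (2 ln (T / s) / s)];
    - the mean of [b] after [s] draws is too high by [eps];
    - the index of the best arm is too low by [eps] after some number of draws.
    Successive draws of [b] have distinct [s] ([sum_over_draws]), so the
    expected number of draws is at most the sum over [s] of the probabilities.
    The first and third ones sum to [2 / eps ^+ 2] each. The second one is
    probable up to [s] close to [2 ln (2 T Delta ^+ 2) / (2 Delta - 3 eps) ^+ 2],
    which is the leading term, and decays geometrically from there on. The last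
    deviation does not depend on [s]: its probability is counted [T] times, and
    is of order [sqrt (ln y) / y] with [y = T eps ^+ 2].

    All these probabilities come from one maximal inequality, [line_crossing]:
    [lam W i n >= c + n lam ^+ 2 / 2] holds for some [n] with probability at
    most [exp (- c)]. It is Ville's inequality for the martingale
    [exp (lam W i n - n lam ^+ 2 / 2)]. The first three deviations force the
    walk across a well-chosen line. The last one is the crossing of the curve
    [sqrt (2 n ln (T / n)) + n eps]; its range is cut into geometric blocks,
    and on each block the square root is replaced by its chord. A ratio
    [1 + 1 / sqrt (ln y)] between the square roots of the ends of a block loses
    only a constant factor on each probability, and makes the number of blocks
    that matter of order [sqrt (ln y)] ([index_underestimates_event]).

    The outcome is [draws_bound], whence the explicit regret bound. As [eps]
    decreases like [(ln T) ^ (- 1 / 8)], every term of [draws_bound] except the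
    leading one is negligible against [ln T], and the leading one is equivalent
    to [ln T / (2 Delta ^+ 2)]. For the worst case, the regret is at most
    [T Delta], which suffices when [Delta sqrt T <= 328]; otherwise
    [draws_bound] is small enough ([worst_case_bound]). *)

(** * Exponential moments and independence *)

Section normal_exponential_moment.
Context {R : realType}.
Local Open Scope ereal_scope.
Local Notation leb := (@lebesgue_measure R).

(** The Radon-Nikodym derivative of the law agrees almost everywhere with
    [normal_pdf m s], both having the same integral on every measurable set. *)
Lemma ge0_integral_normal_prob (m s : R) (f : R -> \bar R) :
  measurable_fun [set: R] f -> (forall x, 0 <= f x) ->
  \int[normal_prob m s]_x f x = \int[leb]_x (f x * (normal_pdf m s x)%:E).
Proof.
move=> mf f0; have dom := normal_prob_dominates m s.
rewrite -(Radon_Nikodym_SigmaFinite.change_of_variables dom)//.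
apply: ae_eq_integral => //.
- apply: emeasurable_funM => //; apply: (measurable_int leb).
  exact: Radon_Nikodym_SigmaFinite.f_integrable.
- apply: emeasurable_funM => //; apply/measurable_EFinP.
  exact: measurable_normal_pdf.
apply: ae_eqe_mul2l; apply: integral_ae_eq => //.
- exact: Radon_Nikodym_SigmaFinite.f_integrable.
- by apply/measurable_EFinP; exact: measurable_normal_pdf.
- by move=> E _ mE; rewrite -Radon_Nikodym_SigmaFinite.f_integral.
Qed.

(** Completing the square, the product of the density with mean [m] and of the
    exponential is the density with mean [m + lam]. *)
Lemma normal_exponential_moment (m lam : R) :
  \int[normal_prob m 1]_x (expR (lam * (x - m) - lam ^+ 2 / 2))%:E = 1.
Proof.
rewrite ge0_integral_normal_prob; last 2 first.
- apply/measurable_EFinP; apply: measurableT_comp => //.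
  apply: measurable_funB => //; apply: measurable_funM => //.
  exact: measurable_funB.
- by move=> x; rewrite lee_fin expR_ge0.
rewrite -(@integral_normal_pdf R (m + lam) 1).
apply: eq_integral => x _; rewrite -EFinM !normal_pdfE ?oner_neq0//.
rewrite mulrCA /normal_fun -expRD; congr ((_ * expR _)%:E).
by field.
Qed.

Lemma expectation_normal_exponential d (T : measurableType d)
    (P : probability T R) (X : {RV P >-> R}) (m lam : R) :
  (forall B, measurable B -> distribution P X B = normal_prob m 1 B) ->
  \int[P]_w (expR (lam * (X w - m) - lam ^+ 2 / 2))%:E = 1.
Proof.
move=> Xnormal; pose phi x := expR (lam * (x - m) - lam ^+ 2 / 2).
(* [normal_prob] is a measure on the copy [measurableTypeR R] of the Borel line,
   and [X] takes its values in the other one, with the same measurable sets. *)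
have mX : measurable_fun setT (X : T -> measurableTypeR R).
  exact: (@measurable_funPT _ _ _ _ X).
pose X' : {mfun T >-> measurableTypeR R} := HB.pack (X : T -> measurableTypeR R)
  (isMeasurableFun.Build _ _ _ _ _ mX).
rewrite -(normal_exponential_moment m lam).
have -> : \int[normal_prob m 1]_x (phi x)%:E =
    \int[distribution P X']_x (phi x)%:E.
  by apply: eq_measure_integral => A mA _; exact/esym/Xnormal.
rewrite ge0_integral_distribution//; last first.
  by move=> x; rewrite lee_fin expR_ge0.
apply/measurable_EFinP; apply: measurableT_comp => //.
apply: measurable_funB => //; apply: measurable_funM => //.
exact: measurable_funB.
Qed.

End normal_exponential_moment.

Section independent_product.
Context {d d1 d2} {T : measurableType d} {T1 : measurableType d1}
  {T2 : measurableType d2} {R : realType} (P : probability T R).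
Local Open Scope ereal_scope.

(** Independence says that the joint law of [Y] and [X] agrees on rectangles
    with the product of their laws, hence everywhere; the integral over the
    product then factors by Tonelli's theorem. *)
Lemma ge0_expectation_indepM (Y : {mfun T >-> T1}) (X : {mfun T >-> T2})
    (f : T1 -> R) (g : T2 -> R) :
  (forall A B, measurable A -> measurable B ->
     P (Y @^-1` A `&` X @^-1` B) = P (Y @^-1` A) * P (X @^-1` B)) ->
  measurable_fun setT f -> measurable_fun setT g ->
  (forall y, 0 <= f y)%R -> (forall x, 0 <= g x)%R ->
  \int[P]_w ((f (Y w) * g (X w))%:E) =
  (\int[P]_w (f (Y w))%:E) * (\int[P]_w (g (X w))%:E).
Proof.
move=> ind mf mg f0 g0.
have mYX : measurable_fun setT (fun w => (Y w, X w)).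
  exact: measurable_fun_pair.
pose YX : {mfun T >-> (T1 * T2)%type} := HB.pack (fun w => (Y w, X w))
  (isMeasurableFun.Build _ _ _ _ _ mYX).
have mfg : measurable_fun setT (fun z : T1 * T2 => (f z.1 * g z.2)%:E).
  apply/measurable_EFinP; apply: measurable_funM;
  by apply: measurableT_comp.
have -> : \int[P]_w ((f (Y w) * g (X w))%:E) =
    \int[distribution P YX]_z (f z.1 * g z.2)%:E.
  rewrite ge0_integral_distribution// => z.
  by rewrite lee_fin mulr_ge0.
pose PY := distribution P Y; pose PX := distribution P X.
have -> : \int[distribution P YX]_z (f z.1 * g z.2)%:E =
    \int[(PY \x PX)%E]_z (f z.1 * g z.2)%:E.
  apply: eq_measure_integral => A mA _; apply/esym.
  apply: (@product_measure_unique _ _ _ _ _ PY PX) => //=.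
rewrite fubini_tonelli1//=; last by move=> z; rewrite lee_fin mulr_ge0.
rewrite /fubini_F/=.
transitivity (\int[PY]_x ((f x)%:E * \int[PX]_y (g y)%:E)).
  apply: eq_integral => x _; under eq_integral do rewrite EFinM.
  rewrite ge0_integralZl//; last 2 first.
  - by move=> y _; rewrite lee_fin.
  - by rewrite lee_fin.
  exact/measurable_EFinP.
have mf' : measurable_fun setT (EFin \o f) by exact/measurable_EFinP.
have mg' : measurable_fun setT (EFin \o g) by exact/measurable_EFinP.
rewrite ge0_integralZr//; last 2 first.
- by move=> y _; rewrite lee_fin.
- by apply: integral_ge0 => y _; rewrite lee_fin.
by congr (_ * _); rewrite ge0_integral_distribution// => y; rewrite lee_fin.
Qed.

End independent_product.

Section past.
Context {R : realType} {d : measure_display} {T : measurableType d}.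
Variable P : probability T R.
Variable Y : nat -> {RV P >-> R}.
Hypothesis Yindep : mutually_independent Y.
Local Open Scope ereal_scope.

(** A pi-system that generates the sigma-algebra of [Y 0], ..., [Y n.-1]. *)
Definition past_boxes (n : nat) : set (set T) :=
  [set \bigcap_(j in [set` iota 0 n]) (Y j @^-1` B j)
     | B in [set B : nat -> set R | forall j, measurable (B j)]].

Lemma past_boxes_setI n : setI_closed (past_boxes n).
Proof.
move=> _ _ [B mB <-] [C mC <-]; exists (fun j => B j `&` C j).
  by move=> j; exact: measurableI.
by rewrite -bigcapI.
Qed.

Lemma past_boxes_setT n : past_boxes n setT.
Proof. by exists (fun=> setT) => //; exact: bigcapT. Qed.

Lemma past_boxes_measurable n : past_boxes n `<=` measurable.
Proof.
move=> _ [B mB <-]; rewrite bigcap_seq; apply: bigsetI_measurable => j _.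
by rewrite -[X in measurable X]setTI; exact: measurable_funPT.
Qed.

(** Both sides are finite measures of [A]. By independence they agree on the
    pi-system [past_boxes n], hence on the sigma-algebra that it generates. *)
Lemma past_next_indep n A B : <<s past_boxes n >> A -> measurable B ->
  P (A `&` Y n @^-1` B) = P A * P (Y n @^-1` B).
Proof.
move=> sA mB; have mD : measurable (Y n @^-1` B).
  by rewrite -[X in measurable X]setTI; exact: measurable_funPT.
have k0 : (0 <= fine (P (Y n @^-1` B)))%R by rewrite fine_ge0.
have -> : P (A `&` Y n @^-1` B) = mrestr P mD A by [].
rewrite muleC -[X in X * _]fineK ?fin_num_measure//.
have -> : (fine (P (Y n @^-1` B)))%:E * P A = mscale (NngNum k0) P A by [].
apply: (@g_sigma_algebra_measure_unique _ _ _ (past_boxes n)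
   (@past_boxes_measurable n) (fun=> setT)) => //.
- by move=> _; exact: past_boxes_setT.
- by apply: bigcup_const; exists 0%N.
- exact: past_boxes_setI.
- move=> _ [C mC <-]; rewrite -[LHS]/(P (_ `&` _)) -[RHS]/((fine _)%:E * P _).
  rewrite fineK ?fin_num_measure//.
  (* [C'] extends the box of the past by [B] in the coordinate [n]. *)
  pose C' j := if j == n then B else C j.
  have C'E j : j \in iota 0 n -> C' j = C j.
    rewrite mem_iota /C' => /andP[_]; rewrite add0n.
    by case: eqP => // ->; rewrite ltnn.
  have -> : \bigcap_(j in [set` iota 0 n]) (Y j @^-1` C j) =
            \bigcap_(j in [set` iota 0 n]) (Y j @^-1` C' j).
    by apply: eq_bigcapr => j /= /C'E ->.
  rewrite (Yindep (iota_uniq 0 n)); last by move=> j; rewrite /C'; case: eqP.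
  have -> : Y n @^-1` B = Y n @^-1` C' n by rewrite /C' eqxx.
  have -> : \bigcap_(j in [set` iota 0 n]) (Y j @^-1` C' j) `&` Y n @^-1` C' n =
      \bigcap_(j in [set` iota 0 n.+1]) (Y j @^-1` C' j).
    by rewrite -addn1 iotaD !bigcap_seq big_cat/= big_seq1 add0n.
  rewrite Yindep ?iota_uniq//; last by move=> j; rewrite /C'; case: eqP.
  by rewrite -addn1 iotaD big_cat/= big_seq1 add0n muleC.
- move=> k; rewrite -[ltLHS]/(P (_ `&` _)) setTI.
  by rewrite (le_lt_trans (probability_le1 _ _))// ltry.
Qed.

Lemma past_measurable n j : (j < n)%N ->
  @measurable_fun _ _ (g_sigma_algebraType (past_boxes n)) R setT (Y j).
Proof.
move=> jn _ B mB; rewrite setTI; apply: sub_gen_smallest.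
exists (fun i => if i == j then B else setT) => /=.
  by move=> i; case: eqP.
rewrite bigcap_seq (bigD1_seq j) ?iota_uniq ?mem_iota//= eqxx.
rewrite big1 ?setIT// => i /negPf ->.
by rewrite preimage_setT.
Qed.

(** A function of the past is a function [f] on [T] that is measurable for the
    past sigma-algebra; it plays the part of a function of the identity map from
    [T] to [T] equipped with that sigma-algebra. *)
Lemma past_next_expectationM n (f : T -> R) (g : R -> R) :
  @measurable_fun _ _ (g_sigma_algebraType (past_boxes n)) R setT f ->
  measurable_fun [set: R] g ->
  (forall w, 0 <= f w)%R -> (forall x, 0 <= g x)%R ->
  \int[P]_w ((f w * g (Y n w))%:E) =
  (\int[P]_w (f w)%:E) * (\int[P]_w (g (Y n w))%:E).
Proof.
move=> mf mg f0 g0.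
pose S := g_sigma_algebraType (past_boxes n).
have mid : measurable_fun setT (id : T -> S).
  move=> _ B mB; rewrite setTI preimage_id.
  exact: (smallest_sub (@sigma_algebra_measurable _ T)
    (@past_boxes_measurable n)).
pose Id : {mfun T >-> S} := HB.pack (id : T -> S)
  (isMeasurableFun.Build _ _ _ _ _ mid).
apply: (ge0_expectation_indepM (Y := Id) (X := Y n)) => // A B mA mB.
by rewrite /= preimage_id past_next_indep.
Qed.

End past.

(** * A maximal inequality for Gaussian walks *)

Section crossing.
Context {R : realType}.
Variables (m lam c : R).

(** The steps [f k] live on an arbitrary type [U], so that measurability makes
    sense both for the ambient sigma-algebra and for that of the past. *)
Definition walk (U : Type) (f : nat -> U -> R) (n : nat) (w : U) : R :=
  \sum_(k < n) (f k w - m).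

Definition crossed (U : Type) (f : nat -> U -> R) (n : nat) (w : U) : bool :=
  has (fun k => c + k%:R * (lam ^+ 2 / 2) <= lam * walk f k w) (iota 0 n.+1).

Definition exp_walk (U : Type) (f : nat -> U -> R) (n : nat) (w : U) : R :=
  expR (lam * walk f n w - n%:R * (lam ^+ 2 / 2)).

(** The exponential walk, frozen at the level [expR c] from the first crossing
    on. At a crossing the walk itself is at least [expR c]. *)
Definition stopped_exp_walk (U : Type) (f : nat -> U -> R) (n : nat) (w : U) :=
  if crossed f n w then expR c else exp_walk f n w.

Lemma crossedS U f n (w : U) : crossed f n.+1 w =
  crossed f n w ||
  (c + n.+1%:R * (lam ^+ 2 / 2) <= lam * walk f n.+1 w).
Proof. by rewrite /crossed -[n.+2]addn1 iotaD has_cat/= orbF add0n. Qed.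

Section measurability.
Context d (U : measurableType d) (f : nat -> U -> R).

Lemma measurable_walk n : (forall k, (k < n)%N -> measurable_fun setT (f k)) ->
  measurable_fun setT (walk f n).
Proof.
move=> mf; apply: measurable_sum => i; apply: measurable_funB => //.
exact: mf.
Qed.

Lemma measurable_crossed n :
  (forall k, (k < n)%N -> measurable_fun setT (f k)) ->
  measurable_fun setT (crossed f n).
Proof.
elim: n => [|n IH] mf.
  rewrite (_ : crossed f 0 = fun w =>
    c + 0%:R * (lam ^+ 2 / 2) <= lam * walk f 0 w); last first.
    by apply/funext => w; rewrite /crossed/= orbF.
  apply: measurable_fun_ler => //; apply: measurable_funM => //.
  exact: measurable_walk.
rewrite (_ : crossed f n.+1 = fun w => crossed f n w ||
  (c + n.+1%:R * (lam ^+ 2 / 2) <= lam * walk f n.+1 w)); last first.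
  by apply/funext => w; exact: crossedS.
apply: measurable_or.
  by apply: IH => k kn; apply: mf; exact: ltnW.
apply: measurable_fun_ler => //; apply: measurable_funM => //.
exact: measurable_walk.
Qed.

Lemma measurable_exp_walk n :
  (forall k, (k < n)%N -> measurable_fun setT (f k)) ->
  measurable_fun setT (exp_walk f n).
Proof.
move=> mf; apply: measurableT_comp => //; apply: measurable_funB => //.
by apply: measurable_funM => //; exact: measurable_walk.
Qed.

End measurability.

End crossing.

Section ville.
Context {R : realType} {d : measure_display} {T : measurableType d}.
Variables (P : probability T R) (Y : nat -> {RV P >-> R}) (m : R).
Hypothesis Yindep : mutually_independent Y.
Hypothesis Ynormal : forall k (B : set R), measurable B ->
  distribution P (Y k) B = normal_prob m 1 B.
Variables lam c : R.
Local Open Scope ereal_scope.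

Let phi (x : R) : R := expR (lam * (x - m) - lam ^+ 2 / 2).

Let measurable_phi : measurable_fun [set: R] phi.
Proof.
apply: measurableT_comp => //; apply: measurable_funB => //.
by apply: measurable_funM => //; exact: measurable_funB.
Qed.

Let expectation_phi k : \int[P]_w (phi (Y k w))%:E = 1.
Proof. exact: expectation_normal_exponential (Ynormal k). Qed.

Local Notation Z := (stopped_exp_walk m lam c (fun k => Y k : T -> R)).

Lemma measurable_stopped_exp_walk n : measurable_fun setT (Z n).
Proof.
apply: measurable_fun_ifT => //; first by apply: measurable_crossed.
exact: measurable_exp_walk.
Qed.

Lemma stopped_exp_walk_ge0 n w : (0 <= Z n w)%R.
Proof. by rewrite /stopped_exp_walk; case: ifP => _; rewrite expR_ge0. Qed.

(** The stopped process is a supermartingale: after a crossing it is constant,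
    and before a crossing it is multiplied by an independent factor of mean 1,
    then possibly lowered to [expR c]. *)
Lemma expectation_stopped_exp_walk_le1 n : \int[P]_w (Z n w)%:E <= 1.
Proof.
elim: n => [|n IH].
  rewrite -(probability_setT P) -[leRHS]mul1e -integral_cst//.
  apply: ge0_le_integral => //.
  - by move=> w _; rewrite lee_fin stopped_exp_walk_ge0.
  - by apply/measurable_EFinP; exact: measurable_stopped_exp_walk.
  move=> w _; rewrite lee_fin /stopped_exp_walk /crossed /exp_walk/= /walk.
  rewrite big_ord0 mulr0 mul0r addr0 subr0 expR0 orbF.
  by case: ifP => // c0; rewrite -expR0 ler_expR.
apply: le_trans IH.
pose cr := crossed m lam c (fun k => Y k : T -> R) n.
(* [a] is the frozen part of the process and [b] its running part. *)
pose a w : R := if cr w then expR c else 0%R.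
pose b w : R := if cr w then 0%R else exp_walk m lam (fun k => Y k : T -> R) n w.
have a0 w : (0 <= a w)%R by rewrite /a; case: ifP => // _; rewrite expR_ge0.
have b0 w : (0 <= b w)%R by rewrite /b; case: ifP => // _; rewrite expR_ge0.
have ma : measurable_fun setT a.
  by apply: measurable_fun_ifT => //; apply: measurable_crossed.
have mb : measurable_fun setT b.
  apply: measurable_fun_ifT => //; first by apply: measurable_crossed.
  exact: measurable_exp_walk.
have mbphi : measurable_fun setT (fun w => (b w * phi (Y n w))%:E).
  apply/measurable_EFinP; apply: measurable_funM => //.
  exact: measurableT_comp.
apply: (@le_trans _ _ (\int[P]_w ((a w)%:E + (b w * phi (Y n w))%:E))).
  apply: ge0_le_integral => //.
  - by move=> w _; rewrite lee_fin stopped_exp_walk_ge0.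
  - by apply/measurable_EFinP; exact: measurable_stopped_exp_walk.
  - by apply: emeasurable_funD => //; exact/measurable_EFinP.
  move=> w _; rewrite -EFinD lee_fin /stopped_exp_walk crossedS /a /b -/(cr w).
  case: (cr w) => /=; first by rewrite mul0r addr0.
  rewrite add0r /phi -expRD.
  have -> : (lam * walk m (fun k => Y k : T -> R) n w - n%:R * (lam ^+ 2 / 2)
      + (lam * (Y n w - m) - lam ^+ 2 / 2) =
      lam * walk m (fun k => Y k : T -> R) n.+1 w
      - n.+1%:R * (lam ^+ 2 / 2))%R.
    by rewrite /walk big_ord_recr/= -(natr1 n); ring.
  by case: ifP => // cross; rewrite ler_expR lerBrDr.
have ma' : measurable_fun setT (EFin \o a) by exact/measurable_EFinP.
have mb' : measurable_fun setT (EFin \o b) by exact/measurable_EFinP.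
have a0' w : setT w -> 0 <= (a w)%:E by rewrite lee_fin.
have b0' w : setT w -> 0 <= (b w)%:E by rewrite lee_fin.
rewrite ge0_integralD//; last first.
  by move=> w _; rewrite lee_fin mulr_ge0// expR_ge0.
rewrite (@past_next_expectationM _ _ _ _ _ Yindep n b phi)//; last 2 first.
- apply: measurable_fun_ifT => //.
    by apply: measurable_crossed => k kn; exact: past_measurable.
  by apply: measurable_exp_walk => k kn; exact: past_measurable.
- by move=> x; rewrite expR_ge0.
rewrite expectation_phi mule1 -ge0_integralD//.
rewrite le_eqVlt; apply/orP; left; apply/eqP; apply: eq_integral => w _.
rewrite /stopped_exp_walk /a /b -/(cr w) -EFinD.
by case: (cr w); rewrite ?addr0 ?add0r.
Qed.

(** Ville's inequality: the stopped process has mean at most 1, and is equal to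
    [expR c] once the line has been crossed. The union over all times [k <= N]
    costs nothing. *)
Lemma line_crossing N :
  P [set w | crossed m lam c (fun k => Y k : T -> R) N w] <= (expR (- c))%:E.
Proof.
pose A := [set w | crossed m lam c (fun k => Y k : T -> R) N w].
have mA : measurable A.
  rewrite -[A]setTI; have /= mcr := @measurable_crossed _ m lam c _ _
    (fun k => Y k : T -> R) N (fun k _ => measurable_funPT (Y k)).
  exact: (mcr measurableT [set true]).
rewrite expRN -[leRHS]mul1e lee_pdivlMr ?expR_gt0//.
apply: le_trans (expectation_stopped_exp_walk_le1 N).
have mZ : measurable_fun setT (fun w => (Z N w)%:E).
  by apply/measurable_EFinP; exact: measurable_stopped_exp_walk.
have Z0 w : setT w -> 0 <= (Z N w)%:E by rewrite lee_fin stopped_exp_walk_ge0.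
apply: (le_trans _ (ge0_subset_integral _ mA measurableT mZ Z0 _)) => //.
rewrite muleC -integral_cst//; apply: ge0_le_integral => //.
- by move=> w _; rewrite lee_fin expR_ge0.
- exact: measurable_funTS.
- by move=> w Aw; rewrite lee_fin /stopped_exp_walk ifT.
Qed.

End ville.

(** * Geometric sums *)

Section geometric_sums.
Context {R : realType}.

Lemma sum_expR_le (r : R) n : 0 < r ->
  \sum_(1 <= s < n.+1) expR (- (r * s%:R)) <= (expR r - 1)^-1.
Proof.
move=> r0; have r1 : 0 < expR r - 1 by rewrite subr_gt0 expR_gt1.
suff -> : \sum_(1 <= s < n.+1) expR (- (r * s%:R)) =
    (1 - expR (- (r * n%:R))) / (expR r - 1).
  rewrite -[leRHS]mul1r ler_pM2r ?invr_gt0//.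
elim: n => [|n IH]; first by rewrite big_geq// mulr0 oppr0 expR0 subrr mul0r.
rewrite big_nat_recr//= IH.
have -> : expR (- (r * n%:R)) = expR (- (r * n.+1%:R)) * expR r.
  by rewrite -expRD; congr expR; rewrite -natr1; ring.
by field; rewrite gt_eqF.
Qed.

Lemma sum_expR_le_inv (r : R) n : 0 < r ->
  \sum_(1 <= s < n.+1) expR (- (r * s%:R)) <= r^-1.
Proof.
move=> r0; apply: le_trans (sum_expR_le n r0) _.
have r1 : 0 < expR r - 1 by rewrite subr_gt0 expR_gt1.
by rewrite lef_pV2 ?posrE// lerBrDl expR_ge1Dx.
Qed.

(** At most [x] terms are equal to 1; the exponents of the others exceed
    [r * 0], [r * 1], [r * 2], ..., so that they are bounded by 1 and by the
    terms of [sum_expR_le_inv]. *)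
Lemma sum_capped_expR_le (r x : R) n : 0 < r -> 0 <= x ->
  \sum_(1 <= s < n.+1) (if s%:R <= x then 1 else expR (- (r * (s%:R - x)))) <=
  x + 1 + r^-1.
Proof.
move=> r0 x0; have [m /andP[mx xm]] : exists m : nat, m%:R <= x < m.+1%:R.
  by exists (Num.truncn x); rewrite truncn_itv.
have [nm|mn] := leqP n m.
  apply: (@le_trans _ _ (\sum_(1 <= s < n.+1) 1)).
    apply: ler_sum => s _; case: ifPn => //; rewrite -ltNge => xs.
    by rewrite -[leRHS]expR0 ler_expR oppr_le0 mulr_ge0 ?subr_ge0 ?ltW.
  rewrite sumr_const_nat subn1/= (le_trans (_ : _ <= x))//.
    by rewrite (le_trans _ mx)// ler_nat.
  by rewrite -addrA lerDl addr_ge0// invr_ge0 ltW.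
rewrite (big_cat_nat (n := m.+1)) ?ltnS ?(ltnW mn)//=.
apply: (@le_trans _ _ (\sum_(1 <= s < m.+1) 1 +
   \sum_(m.+1 <= s < n.+1) expR (- (r * (s%:R - m.+1%:R))))).
  apply: lerD; apply: ler_sum_nat => s /andP[s1 s2].
    by rewrite ifT// (le_trans _ mx)// ler_nat.
  rewrite ifF; last by apply/negbTE; rewrite -ltNge (lt_le_trans xm)// ler_nat.
  by rewrite ler_expR lerN2 ler_pM2l// lerB// ltW.
rewrite sumr_const_nat subn1/= -addrA lerD//.
rewrite big_ltn ?subrr ?mulr0 ?oppr0 ?expR0 ?lerD2l//.
rewrite -[m.+2]/(1 + m.+1)%N big_addn subSn; last by [].
apply: le_trans (sum_expR_le_inv (n - m.+1) r0).
by apply: ler_sum => s _; rewrite natrD addrK.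
Qed.

End geometric_sums.

(** * Blocks below the square-root boundary *)

Section peeling.
Context {R : realType}.

(** A walk [W] at time [r ^+ 2] below [- (cc * r)] has crossed a line. Indeed
    [(r - p) * (q - r) >= 0] means [r >= (r ^+ 2 + p * q) / (p + q)], where the
    right-hand side, affine in the time, is the chord of the square root. The
    conclusion has the form of [crossed] with [lam = - (2 * cc / (p + q))]. *)
Lemma block_crossing (p q cc W r : R) : 0 < p -> p <= r <= q -> 0 <= cc ->
  W <= - (cc * r) ->
  2 * cc ^+ 2 * p * q / (p + q) ^+ 2 + r ^+ 2 * ((- (2 * cc / (p + q))) ^+ 2 / 2)
  <= - (2 * cc / (p + q)) * W.
Proof.
move=> p0 /andP[pr rq] cc0 Wr.
have pq0 : 0 < p + q by lra.
have -> : 2 * cc ^+ 2 * p * q / (p + q) ^+ 2 +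
    r ^+ 2 * ((- (2 * cc / (p + q))) ^+ 2 / 2) =
    2 * cc / (p + q) * (cc * ((r ^+ 2 + p * q) / (p + q))).
  by field; rewrite gt_eqF.
rewrite mulNr -mulrN ler_wpM2l ?divr_ge0 ?mulr_ge0 ?(ltW pq0)//.
apply: (@le_trans _ _ (cc * r)); last by lra.
rewrite ler_wpM2l// ler_pdivrMr//; nra.
Qed.

(** With [A] the square root in the hypothesis, [W] is below
    [- ((A + eps) * r) * r], and the square of [(A + eps) * r] is at least
    [A ^+ 2 * r ^+ 2 + eps ^+ 2 * r ^+ 2] since the cross term is nonnegative;
    then [r] is compared with the ends of the block. *)
Lemma block_boundary (n p q W eps : R) (s : nat) (r := Num.sqrt s%:R) :
  (1 <= s)%N -> s%:R <= n -> 0 < p -> 0 < eps -> p <= r <= q ->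
  W / s%:R + Num.sqrt (2 * ln (n / s%:R) / s%:R) <= - eps ->
  W <= - (Num.sqrt (Num.max 0 (2 * ln (n / q ^+ 2) + p ^+ 2 * eps ^+ 2)) * r).
Proof.
move=> s1 sn p0 eps0 /andP[pr rq] hW.
have s0 : 0 < s%:R :> R by rewrite ltr0n.
have r2 : r ^+ 2 = s%:R by rewrite sqr_sqrtr// ler0n.
have r0 : 0 < r by rewrite sqrtr_gt0.
set A := Num.sqrt (2 * ln (n / s%:R) / s%:R) in hW.
have lns : 0 <= ln (n / s%:R) by rewrite ln_ge0// ler_pdivlMr// mul1r.
have A0 : 0 <= A by exact: sqrtr_ge0.
have A2 : A ^+ 2 * s%:R = 2 * ln (n / s%:R).
  rewrite sqr_sqrtr; last by rewrite divr_ge0 ?mulr_ge0// ltW.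
  by rewrite divfK// gt_eqF.
have WA : W <= - ((A + eps) * r * r).
  have : W / s%:R <= - (A + eps) by lra.
  rewrite ler_pdivrMr// => /le_trans; apply.
  by rewrite -r2 expr2; lra.
apply: (le_trans WA); rewrite lerN2 ler_pM2r//.
have Ar0 : 0 <= (A + eps) * r by rewrite mulr_ge0// ?addr_ge0// ltW.
rewrite -[leRHS]ger0_norm//.
rewrite -sqrtr_sqr ler_sqrt ?sqr_ge0// ge_max sqr_ge0/=.
have lnq : ln (n / q ^+ 2) <= ln (n / s%:R).
  have n0 : 0 < n by exact: lt_le_trans sn.
  rewrite ler_ln ?posrE ?divr_gt0 ?exprn_gt0//; last by lra.
  rewrite ler_pM2l// lef_pV2 ?posrE ?exprn_gt0//; last by lra.
  by rewrite -r2 ler_sqr ?nnegrE; lra.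
have : p ^+ 2 <= r ^+ 2 by rewrite ler_sqr ?nnegrE; lra.
rewrite exprMn r2 => p2.
have : p ^+ 2 * eps ^+ 2 <= s%:R * eps ^+ 2 by rewrite ler_wpM2r// sqr_ge0.
have : 0 <= A * eps * s%:R by rewrite !mulr_ge0// ltW.
nra.
Qed.

Lemma expR1_le3 : expR 1 <= 3 :> R.
Proof.
(* [1 - x <= expR (- x)] at [x = 1 / 6] gives [expR 1 <= (6 / 5) ^+ 6 < 3]. *)
have h : (5 / 6 : R) <= expR (- (1 / 6)).
  by apply: le_trans (expR_ge1Dx _); lra.
have e6 : expR 1 = (expR (- (1 / 6))) ^- 6 :> R.
  by rewrite -expRM_natl -expRN; congr expR; lra.
have h0 : 0 < 5 / 6 :> R by lra.
rewrite e6 (@le_trans _ _ ((5 / 6) ^- 6))//.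
  rewrite lef_pV2 ?posrE ?exprn_gt0 ?expR_gt0//.
  by rewrite ler_pXn2r ?nnegrE ?expR_ge0// ltW.
rewrite invf_ple ?posrE ?exprn_gt0//; lra.
Qed.

Lemma expR2_le9 : expR 2 <= 9 :> R.
Proof.
rewrite -[2]mulr1 expRM_natl (_ : 9 = 3 ^+ 2); last by ring.
by rewrite ler_sqr ?nnegrE ?expR_ge0// expR1_le3.
Qed.

(** The tangent of the exponential at [3 / 2], whose slope [expR (3 / 2)] is at
    least [(5 / 4) ^+ 6 >= 15 / 4]. *)
Lemma expR_ge_tangent (x : R) : (15 / 4) * (x - 1 / 2) <= expR x.
Proof.
have [x0|x0] := leP x (1 / 2); first by have := expR_ge0 x; nra.
have -> : expR x = expR (x - 3 / 2) * (expR (1 / 4)) ^+ 6.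
  by rewrite -expRM_natl -expRD; congr expR; lra.
have h1 : (5 / 4) <= expR (1 / 4 : R) by apply: le_trans (expR_ge1Dx _); lra.
have h2 : x - 1 / 2 <= expR (x - 3 / 2) by apply: le_trans (expR_ge1Dx _); lra.
have h3 : (5 / 4) ^+ 6 <= expR (1 / 4 : R) ^+ 6.
  by rewrite ler_pXn2r ?nnegrE ?expR_ge0//; lra.
rewrite mulrC; apply: ler_pM => //; [lra|].
by apply: le_trans h3; lra.
Qed.

(** Exponent of one block, in logarithmic scale. Here [expR l] is [T eps ^+ 2],
    [expR X] is the left end of the block in units of [1 / eps ^+ 2], [2 * eta]
    is the logarithm of its ratio, and [kappa] is the loss due to the chord. Up
    to the additive constant 3, half of [`|X|] is saved on top of [l]: for
    [X <= 0] the term [- kappa * X] is enough, and for large [X] the term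
    [expR X] takes over. *)
Lemma block_exponent (l kappa eta X : R) : 7 / 8 <= kappa <= 1 ->
  (1 - kappa) * l <= 1 / 4 -> 0 <= eta <= 3 / 4 ->
  l + `|X| / 2 - 3 <= kappa * (l - 2 * eta - X + expR X / 2).
Proof.
move=> /andP[k1 k2] kl /andP[e1 e2].
have M0 := expR_ge0 X; have Mt := expR_ge_tangent X.
set M := expR X in M0 Mt *.
have ke : kappa * eta <= 3 / 4 by nra.
have kM : 7 / 8 * M <= kappa * M by rewrite ler_wpM2r.
rewrite mulrDr !mulrBr; have [X0|X0] := leP 0 X.
  have kX : kappa * X <= X by nra.
  rewrite ger0_norm//; lra.
have kX : kappa * X <= 7 / 8 * X by nra.
rewrite ltr0_norm//; lra.
Qed.

End peeling.

Section blocks.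
Context {R : realType}.

(** The integers between [- K] and [K], as real numbers; 0 is listed twice. *)
Definition block_indices (K : nat) : seq R :=
  [seq k%:R | k <- iota 0 K.+1] ++ [seq - k%:R | k <- iota 0 K.+1].

(** The block of [s] is given by the integer part of the logarithm of
    [Num.sqrt s%:R * eps] in base [expR eta]. *)
Lemma blocks_cover (eta eps : R) (N : nat) : 0 < eta -> 0 < eps ->
  exists K, forall s, (1 <= s <= N)%N -> exists2 x, x \in block_indices K &
    expR (x * eta) / eps <= Num.sqrt s%:R <= expR (eta + x * eta) / eps.
Proof.
move=> eta0 eps0; pose z s : R := ln (Num.sqrt s%:R * eps) / eta.
exists (\max_(s < N.+1) `|Num.floor (z s)|)%N => s /andP[s1 sN].
set K := (\max_(_ < _) _)%N.
have absK : (`|Num.floor (z s)| <= K)%N.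
  by rewrite /K (leq_bigmax (Ordinal (sN : (s < N.+1)%N))).
have s0 : 0 < Num.sqrt s%:R :> R by rewrite sqrtr_gt0 ltr0n.
have /andP[z1 z2] := floor_itv (z s).
exists (Num.floor (z s))%:~R.
  rewrite /block_indices mem_cat; apply/orP.
  have [f0|f0] := leP 0%R (Num.floor (z s)).
    left; apply/mapP; exists `|Num.floor (z s)|%N.
      by rewrite mem_iota ltnS.
    by rewrite -[in LHS](gez0_abs f0).
  right; apply/mapP; exists `|Num.floor (z s)|%N.
    by rewrite mem_iota ltnS.
  by rewrite -[LHS]opprK -mulrNz -(ltz0_abs f0).
rewrite ler_pdivrMr// ler_pdivlMr//.
have se0 : 0 < Num.sqrt s%:R * eps by rewrite mulr_gt0.
rewrite -(lnK (x := Num.sqrt s%:R * eps)) ?posrE// !ler_expR.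
move: z1 z2; rewrite /z ler_pdivlMr// ltr_pdivrMr// intrD => -> /ltW.
by rewrite mulrDl mul1r addrC.
Qed.

Lemma sum_block_indices (eta : R) K : 0 < eta ->
  \sum_(x <- block_indices K) expR (- (`|x| * eta)) <=
    2 * (1 + (expR eta - 1)^-1).
Proof.
move=> eta0; rewrite /block_indices big_cat !big_map.
have E : \sum_(k <- iota 0 K.+1) expR (- (k%:R * eta)) <= 1 + (expR eta - 1)^-1.
  rewrite /= big_cons mul0r oppr0 expR0 lerD2l.
  apply: le_trans (sum_expR_le K eta0).
  rewrite /index_iota subSS subn0.
  by apply: ler_sum => k _; rewrite mulrC.
rewrite mulrDl mul1r -[leRHS]/(_ + _) lerD//;
  apply: le_trans E; apply: ler_sum => k _; by rewrite ?normrN ger0_norm// ler0n.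
Qed.

(** The bound of [line_crossing] for the line of the block [x], where [cc] is
    the height provided by [block_boundary]. The ratio [g = 1 + 1 / sqrt l]
    makes the loss [1 - kappa] of order [1 / l], so that [l] loses at most a
    constant, while the bounds still decay geometrically away from [x = 0]. *)
Lemma block_probability (n eps l eta x : R) (g := expR eta)
    (p := expR (x * eta) / eps) (q := expR (eta + x * eta) / eps)
    (cc := Num.sqrt (Num.max 0 (2 * ln (n / q ^+ 2) + p ^+ 2 * eps ^+ 2))) :
  0 < n -> 0 < eps -> l = ln (n * eps ^+ 2) -> 2 <= l ->
  g = 1 + (Num.sqrt l)^-1 ->
  expR (- (2 * cc ^+ 2 * p * q / (p + q) ^+ 2)) <=
    27 / (n * eps ^+ 2) * expR (- (`|x| * eta)).
Proof.
move=> n0 eps0 lE l2 gE.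
have sl0 : 0 < Num.sqrt l by rewrite sqrtr_gt0; lra.
have sl2 : (Num.sqrt l) ^+ 2 = l by rewrite sqr_sqrtr//; lra.
pose h := (Num.sqrt l)^-1.
have h0 : 0 < h by rewrite invr_gt0.
have h2l : h ^+ 2 * l = 1.
  by rewrite -sl2 exprVn mulVf// sl2 gt_eqF//; lra.
have h2 : h ^+ 2 <= 1 / 2 by nra.
have h34 : h <= 3 / 4 by nra.
have g1 : 1 < g by rewrite gE ltrDl.
have eta0 : 0 < eta by rewrite -(expR_gt1 eta).
have etah : eta <= h.
  by have := expR_ge1Dx eta; rewrite -/g gE lerD2l.
(* [kappa] compares the chord with the square root: it is 1 for [g = 1]. *)
pose kappa := 4 * g / (1 + g) ^+ 2.
have gh : g = 1 + h by [].
have h2' : 0 < 2 + h by lra.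
have kE : 1 - kappa = h ^+ 2 / (2 + h) ^+ 2.
  by rewrite /kappa gh; field; rewrite !gt_eqF//; lra.
have k1 : 1 - kappa <= h ^+ 2 / 4.
  rewrite kE ler_pM2l ?exprn_gt0// lef_pV2 ?posrE ?exprn_gt0//; nra.
have k0 : 0 <= 1 - kappa by rewrite kE divr_ge0 ?sqr_ge0.
have y0 : 0 < n * eps ^+ 2 by rewrite mulr_gt0 ?exprn_gt0.
have p0 : 0 < p by rewrite divr_gt0 ?expR_gt0.
have qE : q = g * p by rewrite /q /p expRD mulrA.
have g0 : 0 < g by lra.
have -> : 2 * cc ^+ 2 * p * q / (p + q) ^+ 2 = kappa * (cc ^+ 2 / 2).
  by rewrite /kappa qE; field; rewrite !gt_eqF//; nra.
have pX : p ^+ 2 * eps ^+ 2 = expR (2 * (x * eta)).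
  by rewrite /p expr_div_n divfK ?sqrf_eq0 ?gt_eqF// -expRM_natl.
have lnq : ln (n / q ^+ 2) = l - 2 * eta - 2 * (x * eta).
  have -> : n / q ^+ 2 = n * eps ^+ 2 / expR (2 * (eta + x * eta)).
    rewrite expRM_natl /q expr_div_n invf_div; field.
    by rewrite gt_eqF ?expR_gt0.
  by rewrite ln_div ?posrE ?expR_gt0// expRK -lE; ring.
have cc2 :
    l - 2 * eta - 2 * (x * eta) + expR (2 * (x * eta)) / 2 <= cc ^+ 2 / 2.
  rewrite ler_pdivlMr// sqr_sqrtr ?le_max ?lexx// lnq pX.
  by apply/orP; right; lra.
have kap : 7 / 8 <= kappa <= 1 by apply/andP; split; lra.
have kl : (1 - kappa) * l <= 1 / 4.
  have : (1 - kappa) * l <= h ^+ 2 / 4 * l by rewrite ler_wpM2r//; lra.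
  by move/le_trans; apply; rewrite mulrAC h2l.
have e34 : 0 <= eta <= 3 / 4 by apply/andP; split; lra.
have := block_exponent (2 * (x * eta)) kap kl e34.
rewrite !normrM (ger0_norm (ltW eta0)) (ger0_norm (_ : 0 <= 2)) => // be.
have kap0 : 0 <= kappa by case/andP: kap; lra.
have kc := ler_wpM2l kap0 cc2.
have y1 : (n * eps ^+ 2)^-1 = expR (- l) by rewrite expRN lE lnK.
apply: (@le_trans _ _ (expR (3 - l - `|x| * eta))).
  by rewrite ler_expR; lra.
have -> : expR (3 - l - `|x| * eta) =
    expR 3 * (expR (- l) * expR (- (`|x| * eta))).
  by rewrite -!expRD; congr expR; ring.
rewrite y1 -mulrA ler_pM2r; last by rewrite mulr_gt0 ?expR_gt0.
have -> : 3 = 3%:R * 1 :> R by rewrite mulr1.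
rewrite expRM_natl (le_trans (_ : _ <= 3 ^+ 3))//; last by lra.
by rewrite ler_pXn2r ?nnegrE ?expR_ge0// expR1_le3.
Qed.

End blocks.

(** * Deviation events *)

Section events.
Context {R : realType} {d : measure_display} {T : measurableType d}.
Variables (P : probability T R) (Y : nat -> {RV P >-> R}) (m : R).
Hypothesis Yindep : mutually_independent Y.
Hypothesis Ynormal : forall k (B : set R), measurable B ->
  distribution P (Y k) B = normal_prob m 1 B.

Local Notation W := (walk m (fun k => Y k : T -> R)).

(** The events are only specified by a lower bound on their extension and by
    an upper bound on their probability: the lines disappear from the sequel. *)
Lemma crossing_event (lam c : R) (N : nat) : exists D : set T,
  [/\ measurable D, (P D <= (expR (- c))%:E)%E &
      forall w k, (k <= N)%N ->
        c + k%:R * (lam ^+ 2 / 2) <= lam * W k w -> D w].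
Proof.
exists [set w | crossed m lam c (fun k => Y k : T -> R) N w]; split.
- rewrite -[X in measurable X]setTI.
  have /= mcr := @measurable_crossed _ m lam c _ _
    (fun k => Y k : T -> R) N (fun k _ => measurable_funPT (Y k)).
  exact: (mcr measurableT [set true]).
- exact: line_crossing.
- by move=> w k kN cross; apply/hasP; exists k; rewrite ?mem_iota.
Qed.

(** [W k >= k eps] with [k >= n] puts the walk above the line of slope
    [eps / 2] through [(n, n eps)]. *)
Lemma deviation_event (eps : R) (n N : nat) : 0 <= eps -> exists D : set T,
  [/\ measurable D, (P D <= (expR (- (eps ^+ 2 / 2 * n%:R)))%:E)%E &
      forall w k, (n <= k <= N)%N -> k%:R * eps <= W k w -> D w].
Proof.
move=> eps0.
have [D [mD PD DP]] := crossing_event eps (eps ^+ 2 / 2 * n%:R) N.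
exists D; split => // w k /andP[nk kN] cross; apply: (DP w k) => //.
have : n%:R <= k%:R :> R by rewrite ler_nat.
nra.
Qed.

Lemma lower_deviation_event (eps : R) (n N : nat) : 0 <= eps ->
  exists D : set T,
  [/\ measurable D, (P D <= (expR (- (eps ^+ 2 / 2 * n%:R)))%:E)%E &
      forall w k, (n <= k <= N)%N -> W k w <= - (k%:R * eps) -> D w].
Proof.
move=> eps0.
have [D [mD PD DP]] := crossing_event (- eps) (eps ^+ 2 / 2 * n%:R) N.
exists D; split => // w k /andP[nk kN] cross; apply: (DP w k) => //.
have : n%:R <= k%:R :> R by rewrite ler_nat.
nra.
Qed.

Lemma probability_bigsetU_le (I : eqType) (s : seq I) (D : I -> set T)
    (a : I -> R) :
  (forall i, i \in s -> measurable (D i) /\ (P (D i) <= (a i)%:E)%E) ->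
  measurable (\big[setU/set0]_(i <- s) D i) /\
  (P (\big[setU/set0]_(i <- s) D i) <= (\sum_(i <- s) a i)%:E)%E.
Proof.
elim: s => [|i s IH] H; first by rewrite !big_nil measure0.
rewrite !big_cons.
have [mi Pi] := H i (mem_head _ _).
have [ms Ps] := IH (fun j js => H j (mem_behead (s := i :: s) js)).
split; first exact: measurableU.
by apply: le_trans (measureU2 _ _ _) _ => //; rewrite EFinD leeD.
Qed.

(** Union over the blocks: the probabilities of [block_probability] sum to
    [27 / y * (2 * (1 + sqrt (ln y)))]. *)
Lemma index_underestimates_event (eps : R) (N : nat) (y := N%:R * eps ^+ 2) :
  (1 <= N)%N -> 0 < eps -> 2 <= ln y ->
  exists D : set T,
  [/\ measurable D, (P D <= (54 * (Num.sqrt (ln y) + 1) / y)%:E)%E &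
      forall w s, (1 <= s <= N)%N ->
        W s w / s%:R + Num.sqrt (2 * ln (N%:R / s%:R) / s%:R) <= - eps -> D w].
Proof.
move=> N1 eps0 l2.
have sl0 : 0 < Num.sqrt (ln y) by rewrite sqrtr_gt0; lra.
pose eta : R := ln (1 + (Num.sqrt (ln y))^-1).
have expeta : expR eta = 1 + (Num.sqrt (ln y))^-1.
  by rewrite lnK// posrE addr_gt0// invr_gt0.
have eta0 : 0 < eta by rewrite -expR_gt1 expeta ltrDl invr_gt0.
have [K Kcov] := blocks_cover N eta0 eps0.
pose p x : R := expR (x * eta) / eps.
pose q x : R := expR (eta + x * eta) / eps.
pose cc x : R := Num.sqrt (Num.max 0
  (2 * ln (N%:R / q x ^+ 2) + p x ^+ 2 * eps ^+ 2)).
pose lam x : R := - (2 * cc x / (p x + q x)).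
pose c x : R := 2 * cc x ^+ 2 * p x * q x / (p x + q x) ^+ 2.
have [D HD] := choice (fun x => crossing_event (lam x) (c x) N).
have N0 : 0 < N%:R :> R by rewrite ltr0n.
have DB x : x \in block_indices K -> measurable (D x) /\
    (P (D x) <= (27 / y * expR (- (`|x| * eta)))%:E)%E.
  move=> _; have [mD PD _] := HD x; split => //; apply: (le_trans PD).
  by rewrite lee_fin; exact: block_probability.
have [mD PD] := probability_bigsetU_le DB.
exists (\big[setU/set0]_(x <- block_indices K) D x); split => //.
- apply: (le_trans PD); rewrite lee_fin -mulr_sumr.
  have y0 : 0 < y by rewrite mulr_gt0 ?exprn_gt0.
  apply: (@le_trans _ _ (27 / y * (2 * (1 + (expR eta - 1)^-1)))).
    by rewrite ler_pM2l ?divr_gt0// sum_block_indices.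
  rewrite expeta addrAC subrr add0r invrK.
  by rewrite le_eqVlt; apply/orP; left; apply/eqP; field; rewrite gt_eqF.
- move=> w s sN low; have [x xK xs] := Kcov s sN.
  rewrite -bigcup_seq; exists x => //=.
  have [_ _ HDx] := HD x; have /andP[s1 sN'] := sN.
  apply: (HDx w s) => //.
  have p0 : 0 < p x by rewrite divr_gt0 ?expR_gt0.
  have s2 : Num.sqrt s%:R ^+ 2 = s%:R :> R by rewrite sqr_sqrtr// ler0n.
  rewrite -{1}s2; apply: block_crossing => //; first exact: sqrtr_ge0.
  have sNR : s%:R <= N%:R :> R by rewrite ler_nat.
  exact: (block_boundary s1 sNR p0 eps0 xs low).
Qed.

End events.

(** * Histories and decisions of the agent *)

Section paths.
Context {R : realType} {d : measure_display} {Omega : measurableType d}.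
Variables (P : probability Omega R) (X : arm -> nat -> {RV P >-> R}).
Variables (pi : strategy R) (w : Omega).

Local Notation h t := (play X pi t w).

Lemma draws_rcons (l : history R) j z i :
  draws (rcons l (j, z)) i = (draws l i + (j == i))%N.
Proof. by rewrite /draws -cats1 count_cat/= addn0. Qed.

Lemma draws_play_total t i : (draws (h t) i + draws (h t) (~~ i))%N = t.
Proof.
elim: t => // t IH; rewrite /= !draws_rcons addnACA IH {IH}.
by case: (pi _); case: i; rewrite /= ?addn0 ?add0n addn1.
Qed.

Lemma play_rewards t i :
  \sum_(az <- h t | az.1 == i) az.2 = \sum_(k < draws (h t) i) X i k w.
Proof.
elim: t => [|t IH]; first by rewrite big_nil big_ord0.
rewrite /= draws_rcons -cats1 big_cat IH big_cons big_nil/=.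
have [<-|_] := eqVneq (pi (h t)) i.
  by rewrite addn1 big_ord_recr/= addr0.
by rewrite addn0 addr0.
Qed.

Lemma emp_mean_play (mu : R) t i : (0 < draws (h t) i)%N ->
  emp_mean (h t) i = mu +
    walk mu (fun k => X i k : Omega -> R) (draws (h t) i) w / (draws (h t) i)%:R.
Proof.
move=> n0; rewrite /emp_mean play_rewards /walk sumrB sumr_const card_ord.
have n0' : (draws (h t) i)%:R != 0 :> R by rewrite pnatr_eq0 -lt0n.
by rewrite -(mulr_natr mu) mulrBl mulfK// addrC subrK.
Qed.

(** Each draw of [i] raises its count by one, so the counts met at the draws of
    [i] are 0, 1, 2, ..., each exactly once. *)
Lemma sum_over_draws (i : arm) (q : nat -> R) t :
  \sum_(s < t) (if pi (h s) == i then q (draws (h s) i) else 0) =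
  \sum_(n < draws (h t) i) q n.
Proof.
elim: t => [|t IH]; first by rewrite !big_ord0.
rewrite big_ord_recr/= IH draws_rcons.
by case: eqP => _; rewrite ?addn1 ?big_ord_recr//= addn0 addr0.
Qed.

End paths.

Section decision.
Context {R : realType} {d : measure_display} {Omega : measurableType d}.
Variables (P : probability Omega R) (X : arm -> nat -> {RV P >-> R}).
Variables (mu : arm -> R) (T : nat) (Delta : R) (tie : history R -> arm).
Variables (b : arm) (w : Omega).
Hypothesis gap : mu (~~ b) - mu b = Delta.

Local Notation pi := (delta_ucb T Delta tie).
Local Notation eps := (eps_ Delta T).
Local Notation W i := (walk (mu i) (fun k => X i k : Omega -> R)).

Lemma argmin_drawsP (l : history R) :
  (draws l (argmin_draws tie l) <= draws l (~~ argmin_draws tie l))%N.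
Proof.
rewrite /argmin_draws; case: ltngtP => //=; try by move/ltnW.
by move=> e; case: (tie l); rewrite /= e.
Qed.

Let gap_step1 (x y D A B S e : R) : y - x = D -> - e < A ->
  y + A + D - 2 * e <= x + B + S -> 2 * D - 3 * e <= B + S.
Proof. by move=> *; lra. Qed.

Let gap_step2 (x y D A B S e : R) : y - x = D -> B < e ->
  ~~ (x + B + D - 2 * e <= y + A + S) -> A + S <= - e.
Proof. by rewrite -ltNge => *; lra. Qed.

(** If [b] is the least drawn arm, it was drawn because its index reached the
    mean of the other arm plus [Delta - 2 * eps]: either that mean is too low
    (case 1; that arm has at least [s] draws) or the index is too high (case 2).
    Otherwise the other arm was not drawn although it was the least drawn one:
    either the mean of [b] is too high (case 3) or the index of the other arm
    is too low (case 4). *)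
Lemma bad_draw_cases t (l := play X pi t w) (s := draws l b) :
  (t < T)%N -> pi l = b -> (0 < s)%N ->
  [\/ exists2 k, (s <= k <= T)%N & W (~~ b) k w <= - (k%:R * eps),
      2 * Delta - 3 * eps <=
        W b s w / s%:R + Num.sqrt (2 * ln (T%:R / s%:R) / s%:R),
      s%:R * eps <= W b s w |
      exists2 k, (1 <= k <= T)%N &
        W (~~ b) k w / k%:R + Num.sqrt (2 * ln (T%:R / k%:R) / k%:R) <= - eps].
Proof.
move=> tT pib s0; have := argmin_drawsP l.
have s0R : 0 < s%:R :> R by rewrite ltr0n.
have total := draws_play_total X pi w t b; rewrite -/l -/s in total.
have sT : (s <= T)%N by rewrite (leq_trans _ (ltnW tT))// -total leq_addr.
have nT : (draws l (~~ b) <= T)%N.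
  by rewrite (leq_trans _ (ltnW tT))// -total leq_addl.
have meanb := emp_mean_play (mu b) s0; rewrite -/l -/s in meanb.
move: pib; rewrite /delta_ucb.
set m := argmin_draws tie l.
have [mb|mb] := eqVneq m b.
  rewrite mb -/s gtn_eqF//= => pib sle.
  have n0 : (0 < draws l (~~ b))%N by exact: leq_trans sle.
  have n0R : 0 < (draws l (~~ b))%:R :> R by rewrite ltr0n.
  move: pib; case: ifPn => [cond _|_ /eqP]; last by case: (b).
  have := emp_mean_play (mu (~~ b)) n0; rewrite -/l => meana.
  have [low|high] := leP (W (~~ b) (draws l (~~ b)) w)
                         (- ((draws l (~~ b))%:R * eps)).
    by constructor 1; exists (draws l (~~ b)) => //; rewrite sle.
  constructor 2; move: cond; rewrite meana meanb.
  have : - eps < W (~~ b) (draws l (~~ b)) w / (draws l (~~ b))%:R.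
    by rewrite ltr_pdivlMr//; lra.
  exact: gap_step1 gap.
have ma : m = ~~ b by move: mb; case: (m); case: (b).
rewrite ma negbK -/s; case: ifPn => [_ /eqP|]; first by case: (b).
rewrite negb_or -lt0n => /andP[n0 cond] _ nle.
have n0R : 0 < (draws l (~~ b))%:R :> R by rewrite ltr0n.
have := emp_mean_play (mu (~~ b)) n0; rewrite -/l => meana.
have [high|low] := leP (s%:R * eps) (W b s w); first by constructor 3.
constructor 4; exists (draws l (~~ b)); first by rewrite n0.
move: cond; rewrite meana meanb.
have : W b s w / s%:R < eps by rewrite ltr_pdivrMr// mulrC.
exact: gap_step2 gap.
Qed.

End decision.

(** * Overestimation of the worse arm *)

Section overestimation.
Context {R : realType} {d : measure_display} {T : measurableType d}.
Variables (P : probability T R) (Y : nat -> {RV P >-> R}) (m : R).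
Hypothesis Yindep : mutually_independent Y.
Hypothesis Ynormal : forall k (B : set R), measurable B ->
  distribution P (Y k) B = normal_prob m 1 B.

Local Notation W := (walk m (fun k => Y k : T -> R)).

(** The width [A] of the index satisfies [A ^+ 2 * s <= 2 * Lam], which is
    [(1 - tau) * dlt ^+ 2 * x1]; so the bound is the inequality between the
    geometric and the arithmetic means of [(1 - tau) * s] and [x1]. It replaces
    the curve [s * A] by a line. The condition [x1 < s] serves to bound
    [ln (n / s)] by [Lam]. *)
Lemma index_width_le (n dlt tau Lam x1 s : R) :
  0 < n -> 0 < dlt -> 0 < tau < 1 -> 1 <= Lam -> ln (n * dlt ^+ 2 / 2) <= Lam ->
  x1 = 2 * Lam / ((1 - tau) * dlt ^+ 2) -> x1 < s -> s <= n ->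
  s * Num.sqrt (2 * ln (n / s) / s) <= dlt * ((1 - tau) * s + x1) / 2.
Proof.
move=> n0 d0 /andP[t0 t1] L1 lnL x1E xs sn.
have th0 : 0 < 1 - tau by lra.
have d20 : 0 < dlt ^+ 2 by rewrite exprn_gt0.
have x1d : x1 * ((1 - tau) * dlt ^+ 2) = 2 * Lam.
  by rewrite x1E divfK// gt_eqF// mulr_gt0.
have x10 : 0 < x1 by rewrite x1E divr_gt0 ?mulr_gt0//; lra.
have s0 : 0 < s by lra.
have sd : 2 <= s * dlt ^+ 2.
  have : x1 * ((1 - tau) * dlt ^+ 2) <= s * dlt ^+ 2.
    by apply: ler_pM; rewrite ?mulr_ge0 ?ltW//; nra.
  lra.
have lns : ln (n / s) <= Lam.
  apply: le_trans lnL; rewrite ler_ln ?posrE ?divr_gt0 ?mulr_gt0//.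
  by rewrite ler_pdivlMr// mulrAC ler_pdivrMr// -mulrA (mulrC _ s) ler_wpM2l// ltW.
have ln0 : 0 <= ln (n / s) by rewrite ln_ge0// ler_pdivlMr// mul1r.
set A := Num.sqrt _.
have A0 : 0 <= A by exact: sqrtr_ge0.
have A2 : A ^+ 2 * s = 2 * ln (n / s).
  by rewrite sqr_sqrtr ?divfK ?gt_eqF// divr_ge0 ?mulr_ge0// ltW.
have thx : 0 <= (1 - tau) * s by rewrite mulr_ge0 ?ltW.
have rhs0 : 0 <= dlt * ((1 - tau) * s + x1) / 2.
  by rewrite divr_ge0// mulr_ge0 ?addr_ge0// ltW.
have lhs0 : 0 <= s * A by rewrite mulr_ge0// ltW.
rewrite -ler_sqr ?nnegrE//.
have -> : (s * A) ^+ 2 = s * (2 * ln (n / s)) by rewrite -A2; ring.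
apply: (@le_trans _ _ (dlt ^+ 2 * ((1 - tau) * s * x1))).
  have -> : dlt ^+ 2 * ((1 - tau) * s * x1) =
    s * (x1 * ((1 - tau) * dlt ^+ 2)) by ring.
  by rewrite x1d ler_wpM2l ?(ltW s0)// ler_wpM2l.
have -> : (dlt * ((1 - tau) * s + x1) / 2) ^+ 2 =
  dlt ^+ 2 * (((1 - tau) * s + x1) ^+ 2 / 4) by field.
rewrite ler_wpM2l ?(ltW d20)//.
by have := sqr_ge0 ((1 - tau) * s - x1); nra.
Qed.

(** Up to [x1] nothing better than the trivial event is used; beyond [x1], an
    index above [dlt] puts the walk above a line by [index_width_le]. The
    parameter [tau] trades the threshold [x1] against the rate [r]. *)
Lemma index_overestimates_event (N s : nat) (dlt tau Lam : R)
    (x1 := 2 * Lam / ((1 - tau) * dlt ^+ 2)) (r := dlt ^+ 2 / 2 * tau) :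
  (1 <= s <= N)%N -> 0 < dlt -> 0 < tau < 1 -> 1 <= Lam ->
  ln (N%:R * dlt ^+ 2 / 2) <= Lam ->
  exists D : set T,
  [/\ measurable D,
      (P D <= (if (s%:R <= x1)%R then 1 else expR (- (r * (s%:R - x1))))%:E)%E &
      forall w, dlt <= W s w / s%:R +
        Num.sqrt (2 * ln (N%:R / s%:R) / s%:R) -> D w].
Proof.
move=> /andP[s1 sN] d0 t01 L1 lnL; have [t0 t1] := andP t01.
have [sx|xs] := leP s%:R x1.
  by exists setT; split=> //; rewrite probability_setT.
have [D [mD PD DP]] :=
  crossing_event Yindep Ynormal (dlt * tau) (r * (s%:R - x1)) s.
exists D; split => // w high; apply: (DP w s) => //.
have s0 : 0 < s%:R :> R by rewrite ltr0n.
have N0 : 0 < N%:R :> R by rewrite ltr0n (leq_trans s1).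
have sNR : s%:R <= N%:R :> R by rewrite ler_nat.
have := index_width_le N0 d0 t01 L1 lnL erefl xs sNR.
set A := Num.sqrt _ in high *; rewrite -/x1 => width.
have : s%:R * dlt <= W s w + s%:R * A.
  have : s%:R * dlt <= s%:R * (W s w / s%:R + A) by rewrite ler_wpM2l// ltW.
  by rewrite mulrDr mulrCA divff ?gt_eqF// mulr1.
move=> lowW.
have : s%:R * dlt - dlt * ((1 - tau) * s%:R + x1) / 2 <= W s w by lra.
move=> /(ler_wpM2l (ltW (mulr_gt0 d0 t0))); apply: le_trans.
by rewrite /r le_eqVlt; apply/orP; left; apply/eqP; field.
Qed.

End overestimation.

Section mean_bounds.
Context {R : realType} {d : measure_display} {T : measurableType d}.
Variable P : probability T R.

(** The counts of bad draws are sums of indicators; this bundle is stable under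
    the operations that build them. *)
Definition mean_le (U : T -> R) (u : R) : Prop :=
  [/\ measurable_fun setT U, forall w, 0 <= U w &
      (\int[P]_w (U w)%:E <= u%:E)%E].

Lemma mean_le_cst (c : R) : 0 <= c -> mean_le (cst c) c.
Proof.
move=> c0; split => //.
by rewrite (integral_cst P measurableT c%:E)//= probability_setT mule1.
Qed.

Lemma mean_le_indic (D : set T) (p : R) : measurable D -> (P D <= p%:E)%E ->
  mean_le (\1_D) p.
Proof.
by move=> mD PD; split => //; rewrite integral_indic// setIT.
Qed.

Lemma mean_leD (U V : T -> R) (u v : R) : mean_le U u -> mean_le V v ->
  mean_le (fun w => U w + V w) (u + v).
Proof.
move=> [mU U0 Uu] [mV V0 Vv]; split.
- exact: measurable_funD.
- by move=> w; rewrite addr_ge0.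
- under eq_integral do rewrite EFinD.
  have mU' : measurable_fun setT (EFin \o U) by exact/measurable_EFinP.
  have mV' : measurable_fun setT (EFin \o V) by exact/measurable_EFinP.
  rewrite ge0_integralD//; last 2 first.
  + by move=> w _; rewrite lee_fin.
  + by move=> w _; rewrite lee_fin.
  by rewrite EFinD leeD.
Qed.

Lemma mean_leZ (k : R) (U : T -> R) (u : R) : 0 <= k -> mean_le U u ->
  mean_le (fun w => k * U w) (k * u).
Proof.
move=> k0 [mU U0 Uu]; split.
- exact: measurable_funM.
- by move=> w; rewrite mulr_ge0.
- under eq_integral do rewrite EFinM.
  have mU' : measurable_fun setT (EFin \o U) by exact/measurable_EFinP.
  rewrite ge0_integralZl//; last by move=> w _; rewrite lee_fin.
  by rewrite EFinM lee_wpmul2l.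
Qed.

Lemma mean_le_sum (s : seq nat) (U : nat -> T -> R) (u : nat -> R) :
  (forall i, i \in s -> mean_le (U i) (u i)) ->
  mean_le (fun w => \sum_(i <- s) U i w) (\sum_(i <- s) u i).
Proof.
elim: s => [|i s IH] H.
  rewrite big_nil; have -> : (fun w => \sum_(i <- [::]) U i w) = cst 0.
    by apply/funext => w; rewrite big_nil.
  exact: mean_le_cst.
rewrite big_cons; have -> : (fun w => \sum_(j <- i :: s) U j w) =
    (fun w => U i w + \sum_(j <- s) U j w).
  by apply/funext => w; rewrite big_cons.
apply: mean_leD; first by apply: H; rewrite mem_head.
by apply: IH => j js; apply: H; rewrite in_cons js orbT.
Qed.

(** The integral of a nonnegative function is a supremum over the simple
    functions below it, hence monotone for arbitrary functions. It will be
    applied to the sum of the means of the chosen arms. *)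
Lemma le_integral_pointwise (f g : T -> R) : (forall w, f w <= g w) ->
  (\int[P]_w (f w)%:E <= \int[P]_w (g w)%:E)%E.
Proof.
have ge0_mono (u v : T -> \bar R) : (forall w, 0 <= u w)%E ->
    (forall w, u w <= v w)%E -> (\int[P]_w u w <= \int[P]_w v w)%E.
  move=> u0 uv; have v0 w : (0 <= v w)%E by exact: le_trans (uv w).
  rewrite !ge0_integralTE//; apply: le_ereal_sup => _ [h /= hu <-].
  by exists h => // w; exact: le_trans (uv w).
move=> fg; rewrite integralE [leRHS]integralE leeB//.
  apply: ge0_mono => w; first exact: funepos_ge0.
  by rewrite !funeposE ge_max !le_max lexx orbT lee_fin fg.
apply: ge0_mono => w; first exact: funeneg_ge0.
by rewrite !funenegE ge_max !le_max lexx orbT !leeN2 lee_fin fg.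
Qed.

Lemma expectation_ge_sub (f U : T -> R) (c u : R) : mean_le U u ->
  (forall w, c - U w <= f w) -> ((c - u)%:E <= 'E_P[f])%E.
Proof.
move=> [mU U0 Uu] fU; rewrite unlock.
apply: le_trans (le_integral_pointwise fU).
have mU' : measurable_fun setT (EFin \o U) by exact/measurable_EFinP.
have iU : P.-integrable setT (EFin \o U).
  apply/integrableP; split => //.
  under eq_integral do rewrite gee0_abs ?lee_fin//.
  by rewrite (le_lt_trans Uu)// ltry.
under eq_integral do rewrite EFinB.
rewrite integralB//; last exact: finite_measure_integrable_cst.
by rewrite integral_cst//= probability_setT mule1 EFinB leeB.
Qed.

End mean_bounds.

(** * The logarithmic scales *)

Section logarithms.
Context {R : realType}.

Lemma ln_le_subr1 (x : R) : 0 < x -> ln x <= x - 1.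
Proof.
by move=> x0; rewrite lerBrDl -[leRHS]lnK ?posrE// expR_ge1Dx.
Qed.

Lemma ln2_bounds : 1 / 2 <= (ln 2 : R) <= 1.
Proof.
have h0 : 0 < 2^-1 :> R by rewrite invr_gt0.
have h := ln_le_subr1 h0; have g := ln_le_subr1 (ltr0n R 2).
by move: h; rewrite lnV ?posrE// => h; apply/andP; split; lra.
Qed.

End logarithms.

Section scale.
Context {R : realType}.
Variables (Delta : R) (T : nat).
Hypothesis Delta_gt0 : 0 < Delta.

Local Notation u := (T%:R * Delta ^+ 2).
Local Notation L := (ln (expR 1 + u)).
Local Notation zeta := (L `^ (- (1 / 8))).
Local Notation eps := (eps_ Delta T).

Lemma log_scale_ge1 : 1 <= L.
Proof.
have u0 : 0 <= u by rewrite mulr_ge0// sqr_ge0.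
have e0 := expR_gt0 (1 : R); have eu : 0 < expR 1 + u by rewrite ltr_wpDr.
by rewrite -[leLHS]expRK ler_ln ?posrE// lerDl.
Qed.

Lemma zeta_gt0 : 0 < zeta.
Proof. by rewrite powR_gt0// (lt_le_trans ltr01 log_scale_ge1). Qed.

Lemma zeta_le1 : zeta <= 1.
Proof.
by rewrite -[leRHS](powRr0 L) ler_powR ?log_scale_ge1//; lra.
Qed.

Lemma zeta_expn8 : zeta ^+ 8 = L^-1.
Proof.
have L0 : 0 <= L by rewrite (le_trans ler01 log_scale_ge1).
rewrite -powR_mulrn ?powR_ge0// -powRrM.
have -> : - (1 / 8) * 8%:R = -1 :> R by lra.
by rewrite powR_inv1.
Qed.

Lemma epsE : eps = Delta / 4 * zeta. Proof. by []. Qed.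

Lemma eps_gt0 : 0 < eps.
Proof. by rewrite epsE mulr_gt0 ?zeta_gt0// divr_gt0. Qed.

Lemma eps_le : eps <= Delta / 4.
Proof. by rewrite epsE ler_piMr ?zeta_le1// divr_ge0// ltW. Qed.

(** The quotient of [2 T Delta ^+ 2] by [T eps ^+ 2] is [32] times the fourth
    root of [L], where [ln L <= ln (T Delta ^+ 2)]. So its logarithm is at most
    [ln 32] plus a quarter of [ln (T Delta ^+ 2)], and at least [ln 32]. *)
Lemma log_scales : 2 <= ln (T%:R * eps ^+ 2) ->
  4 <= ln (2 * T%:R * Delta ^+ 2) <= 9 / 2 * ln (T%:R * eps ^+ 2).
Proof.
set l := ln _ => l2.
have T0 : 0 < T%:R :> R.
  rewrite lt0r ler0n andbT; apply: contraTneq l2 => T0.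
  by rewrite /l T0 mul0r ln0// -ltNge.
have d20 : 0 < Delta ^+ 2 by rewrite exprn_gt0.
have u0 : 0 < u by rewrite mulr_gt0.
have [hl2 hl2'] := andP (@ln2_bounds R).
have lnL0 : 0 <= ln L by rewrite ln_ge0// log_scale_ge1.
have z0 := zeta_gt0.
have lE : l = ln u - 4 * ln 2 - ln L / 4.
  have L0 : 0 < L by exact: lt_le_trans log_scale_ge1.
  have e2 : T%:R * eps ^+ 2 = u * zeta ^+ 2 / 2 ^+ 4 by rewrite epsE; field.
  rewrite /l e2 ln_div ?posrE ?mulr_gt0 ?exprn_gt0//.
  rewrite lnM ?posrE ?exprn_gt0// !lnXn// ln_powR; lra.
have lnu : 4 <= ln u by lra.
have u2 : 2 <= u.
  have := ln_le_subr1 u0.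
  lra.
have Lu : ln L <= ln u.
  rewrite ler_ln ?posrE ?(lt_le_trans ltr01 log_scale_ge1)//.
  have e0 := expR_gt0 (1 : R).
  have e2 : 2 <= expR 1 :> R by apply: le_trans (expR_ge1Dx _); lra.
  have -> : expR 1 + u = expR 1 * (1 + u / expR 1) by field; rewrite gt_eqF.
  have ue0 : 0 < u / expR 1 by rewrite divr_gt0.
  rewrite lnM ?posrE ?addr_gt0// expRK.
  have : ln (1 + u / expR 1) <= u / expR 1.
    by have := ln_le_subr1 (addr_gt0 ltr01 ue0); lra.
  have : u / expR 1 <= u / 2 by rewrite ler_pM2l// lef_pV2 ?posrE.
  lra.
have -> : ln (2 * T%:R * Delta ^+ 2) = ln 2 + ln u.
  by rewrite -lnM ?posrE// mulrA.
by apply/andP; split; lra.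
Qed.

End scale.

(** * From draws to regret *)

Section regret_bounds.
Context {R : realType} {d : measure_display} {Omega : measurableType d}.
Variables (P : probability Omega R) (mu : arm -> R).
Variables (X : arm -> nat -> {RV P >-> R}) (b : arm) (Delta : R).
Hypothesis Delta_gt0 : 0 < Delta.
Hypothesis gap : mu (~~ b) - mu b = Delta.

(** The regret is the mean of [Delta] times the number of draws of [b]. *)
Lemma regret_le_mean (pi : strategy R) (T : nat) (U : Omega -> R) (u : R) :
  mean_le P U u ->
  (forall w, \sum_(t < T) (if pi (play X pi t w) == b then 1 else 0) <= U w) ->
  (regret mu X pi T <= (Delta * u)%:E)%E.
Proof.
move=> HU NU.
have maxE : Num.max (mu false) (mu true) = mu (~~ b).
  have : mu b <= mu (~~ b) by rewrite -subr_ge0 gap ltW.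
  by case: (b) => /= g; [rewrite max_l|rewrite max_r].
have HDU := mean_leZ (ltW Delta_gt0) HU.
have := expectation_ge_sub (f := fun w =>
    \sum_(1 <= t < T.+1) mu (chosen_arm X pi t w)) (c := T%:R * mu (~~ b)) HDU.
rewrite /regret maxE => lower.
have {lower} : ((T%:R * mu (~~ b) - Delta * u)%:E <=
    'E_P[(fun w => (\sum_(1 <= t < T.+1) mu (chosen_arm X pi t w))%R)])%E.
  apply: lower => w; rewrite big_add1/= big_mkord.
  have -> : \sum_(t < T) mu (chosen_arm X pi t.+1 w) = T%:R * mu (~~ b)
      - Delta * \sum_(t < T) (if pi (play X pi t w) == b then 1 else 0).
    rewrite mulr_sumr mulr_natl -[T in mu _ *+ T]card_ord -sumr_const -sumrB.
    apply: eq_bigr => t _; rewrite /chosen_arm/=.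
    have [->|] := eqVneq (pi (play X pi t w)) b.
      by rewrite mulr1 -gap opprB addrC subrK.
    by case: (pi _); case: (b) => //= _; rewrite mulr0 subr0.
  by rewrite lerB// ler_wpM2l// ltW.
case: ('E_P[_])%E => [e| |]; rewrite ?lee_fin// => lower.
- by rewrite lerBlDr addrC -lerBlDr.
- by rewrite addeNy leNye.
Qed.

Lemma regret_le_horizon (pi : strategy R) (T : nat) :
  (regret mu X pi T <= (Delta * T%:R)%:E)%E.
Proof.
apply: (regret_le_mean (mean_le_cst P (ler0n R T))) => w.
rewrite -[leRHS]/(T%:R) -[T in T%:R]card_ord -sumr_const.
by apply: ler_sum => t _; case: ifP.
Qed.

End regret_bounds.

Section arms.
Context {R : realType} {d : measure_display} {Omega : measurableType d}.
Variables (P : probability Omega R) (mu : arm -> R).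
Variables (X : arm -> nat -> {RV P >-> R}).
Hypothesis X_bandit : gaussian_bandit mu X.

Lemma arm_independent i : mutually_independent (X i).
Proof.
move=> J B uJ mB; have [_ ind] := X_bandit.
have uJ' : uniq [seq (i, k) | k <- J] by rewrite map_inj_uniq// => j k [].
have := ind _ (fun ik : arm * nat => B ik.2) uJ' (fun ik => mB ik.2).
by rewrite !bigcap_seq !big_map.
Qed.

Lemma arm_normal i k (B : set R) : measurable B ->
  distribution P (X i k) B = normal_prob (mu i) 1 B.
Proof. by case: X_bandit => + _; exact. Qed.

End arms.

Section bad_draws.
Context {R : realType} {d : measure_display} {Omega : measurableType d}.
Variables (P : probability Omega R) (mu : arm -> R).
Variables (X : arm -> nat -> {RV P >-> R}) (b : arm) (Delta : R) (T : nat).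
Variable tie : history R -> arm.
Hypothesis Delta_gt0 : 0 < Delta.
Hypothesis gap : mu (~~ b) - mu b = Delta.
Hypothesis X_bandit : gaussian_bandit mu X.
Hypothesis T1 : (1 <= T)%N.

Local Notation eps := (eps_ Delta T).
Local Notation dlt := (2 * Delta - 3 * eps).
Local Notation y := (T%:R * eps ^+ 2).
Local Notation Lam := (ln (2 * T%:R * Delta ^+ 2)).

(** The terms are, in order: the first draw of [b], and the draws due to a low
    mean of the other arm, to a high index of [b], to a high mean of [b] and to
    a low index of the other arm. *)
Lemma bad_draws_mean (tau : R) (r := dlt ^+ 2 / 2 * tau)
    (x1 := 2 * Lam / ((1 - tau) * dlt ^+ 2)) : 0 < tau < 1 -> 2 <= ln y ->
  exists U : Omega -> R,
    mean_le P U (1 + (2 / eps ^+ 2 + (x1 + 1 + r^-1) + 2 / eps ^+ 2 +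
      T%:R * (54 * (Num.sqrt (ln y) + 1) / y))) /\
    forall w, \sum_(t < T)
      (if delta_ucb T Delta tie (play X (delta_ucb T Delta tie) t w) == b
       then 1 else 0) <= U w.
Proof.
move=> t01 l2.
have e0 := eps_gt0 T Delta_gt0; have e4 := eps_le T Delta_gt0.
have d0 : 0 < dlt by lra.
have /andP[Lam4 _] := log_scales Delta_gt0 l2.
have T0 : 0 < T%:R :> R by rewrite ltr0n.
have lnd : ln (T%:R * dlt ^+ 2 / 2) <= Lam.
  rewrite ler_ln ?posrE ?divr_gt0 ?mulr_gt0 ?exprn_gt0//.
  have : dlt ^+ 2 <= 4 * Delta ^+ 2 by nra.
  by move=> /(ler_wpM2l (ltW T0)); lra.
have indb := arm_independent X_bandit b.
have normb := arm_normal X_bandit b.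
have inda := arm_independent X_bandit (~~ b).
have norma := arm_normal X_bandit (~~ b).
have [D1 HD1] := choice (fun s => lower_deviation_event inda norma s T (ltW e0)).
(* The statement is vacuous outside of [1 <= s <= T], so that [choice] applies. *)
have HD2' s : exists D : set Omega, (1 <= s <= T)%N -> [/\ measurable D,
    (P D <= (if s%:R <= x1 then 1 else expR (- (r * (s%:R - x1))))%:E)%E &
    forall w, dlt <= walk (mu b) (fun k => X b k : Omega -> R) s w / s%:R +
      Num.sqrt (2 * ln (T%:R / s%:R) / s%:R) -> D w].
  have [sT|] := boolP (1 <= s <= T)%N; last by exists set0.
  have L1 : 1 <= Lam by lra.
  have [D HD] := index_overestimates_event indb normb sT d0 t01 L1 lnd.
  by exists D.
have [D2 HD2] := choice HD2'.
have [D3 HD3] := choice (fun s => deviation_event indb normb s s (ltW e0)).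
have [D4 [mD4 PD4 HD4]] := index_underestimates_event inda norma T1 e0 l2.
(* The number of deviations that can explain a draw at the count [s >= 1]. *)
pose q w s : R := \1_(D1 s) w + \1_(D2 s) w + \1_(D3 s) w.
pose U w : R := 1 + (\sum_(1 <= s < T.+1) \1_(D1 s) w +
  \sum_(1 <= s < T.+1) \1_(D2 s) w + \sum_(1 <= s < T.+1) \1_(D3 s) w +
  T%:R * \1_D4 w).
have x10 : 0 <= x1.
  by rewrite /x1 divr_ge0 ?mulr_ge0 ?sqr_ge0//; have [_] := andP t01; lra.
have r0 : 0 < r.
  by rewrite /r mulr_gt0 ?divr_gt0 ?exprn_gt0//; case/andP: t01.
have r'0 : 0 < eps ^+ 2 / 2 by rewrite divr_gt0 ?exprn_gt0.
have mono u u' : mean_le P U u -> u <= u' -> mean_le P U u'.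
  by move=> [? ? Uu] uu; split => //; apply: le_trans Uu _; rewrite lee_fin.
exists U; split.
- apply: mono.
    apply: mean_leD; first exact: (mean_le_cst P ler01).
    apply: mean_leD; last first.
      by apply: mean_leZ (ltW T0) _; exact: mean_le_indic mD4 PD4.
    apply: mean_leD; first apply: mean_leD.
    + apply: mean_le_sum => s _; have [mD PD _] := HD1 s.
      exact: mean_le_indic mD PD.
    + apply: mean_le_sum => s; rewrite mem_index_iota ltnS => sT.
      by have [mD PD _] := HD2 s sT; exact: mean_le_indic mD PD.
    + apply: mean_le_sum => s _; have [mD PD _] := HD3 s.
      exact: mean_le_indic mD PD.
  have tail := sum_expR_le_inv T r'0; rewrite invf_div in tail.
  rewrite lerD2l lerD2r !lerD//.
  exact: sum_capped_expR_le.
move=> w; set h := fun t => play X (delta_ucb T Delta tie) t w.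
pose Q s : R := if s is 0%N then 1 else q w s + \1_D4 w.
have Q0 s : 0 <= Q s by rewrite /Q /q; case: s => // s; rewrite !addr_ge0.
have drawsT : (draws (h T) b <= T)%N.
  by rewrite -[leqRHS](draws_play_total X (delta_ucb T Delta tie) w T b) leq_addr.
apply: (@le_trans _ _ (\sum_(n < T.+1) Q n)).
  apply: (@le_trans _ _ (\sum_(n < draws (h T) b) Q n)).
    rewrite -sum_over_draws; apply: ler_sum => t _.
    case: eqP => // pib; rewrite -/(h t).
    case sE: (draws (h t) b) => [//|s].
    have s0 : (0 < draws (h t) b)%N by rewrite sE.
    have := bad_draw_cases gap (ltn_ord t) pib s0; rewrite -/(h t) sE.
    have sT : (1 <= s.+1 <= T)%N.
      rewrite -sE s0 (leq_trans _ (ltnW (ltn_ord t)))//.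
      rewrite -[leqRHS](draws_play_total X (delta_ucb T Delta tie) w t b).
      exact: leq_addr.
    have i0 (A : set Omega) : 0 <= \1_A w :> R by [].
    have i1 (A : set Omega) : A w -> \1_A w = 1 :> R.
      by move=> Aw; rewrite indicE mem_set.
    case=> [[k kT low]|high|high|[k kT low]]; rewrite /Q /q.
    + have [_ _ HD] := HD1 s.+1.
      by rewrite (i1 _ (HD w k kT low)) -!addrA lerDl !addr_ge0.
    + have [_ _ HD] := HD2 s.+1 sT.
      by rewrite (i1 _ (HD w high)) (addrC _ 1) -!addrA lerDl !addr_ge0.
    + have [_ _ HD] := HD3 s.+1.
      have ss : (s.+1 <= s.+1 <= s.+1)%N by rewrite leqnn.
      by rewrite (i1 _ (HD w _ ss high)) addrAC lerDr !addr_ge0.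
    + by rewrite (i1 _ (HD4 w k kT low)) lerDr !addr_ge0.
  rewrite -(big_mkord xpredT Q) -(big_mkord xpredT Q).
  rewrite [leRHS](big_cat_nat (n := draws (h T) b))//=; last exact: leqW.
  by rewrite lerDl sumr_ge0.
rewrite big_ord_recl/= /U lerD2l -(big_mkord xpredT (fun n => Q n.+1))/=.
rewrite -(big_add1 _ _ 0 T.+1 xpredT Q)/=.
rewrite mulr_natl -[X in _ *+ X](subn1 T.+1) -sumr_const_nat -!big_split/=.
apply: ler_sum_nat => s /andP[s1 _].
by case: s s1.
Qed.

End bad_draws.

(** * The explicit bound *)

Section tuning.
Context {R : realType}.

(** This [tau] balances the increase [2 * Lam * tau / D] of the threshold and
    the tail [2 / (tau * D)] of the geometric sum, both of order
    [sqrt Lam / D]. *)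
Lemma tuned_threshold (Lam D tau : R) : 0 < D -> 4 <= Lam ->
  tau = (Num.sqrt Lam)^-1 ->
  2 * Lam / ((1 - tau) * D) + (D / 2 * tau)^-1 <=
  2 * Lam / D + 6 * Num.sqrt Lam / D.
Proof.
move=> D0 L4 tauE.
have s2 : Num.sqrt Lam ^+ 2 = Lam by rewrite sqr_sqrtr//; lra.
have s0 : 0 <= Num.sqrt Lam by exact: sqrtr_ge0.
set s := Num.sqrt Lam in s2 s0 tauE *.
have sge2 : 2 <= s by nra.
have s00 : 0 < s by lra.
have h : (1 - tau)^-1 <= 1 + 2 / s.
  have -> : (1 - tau)^-1 = s / (s - 1).
    by rewrite tauE; field; rewrite !gt_eqF//; lra.
  rewrite ler_pdivrMr; last by lra.
  rewrite mulrDl mul1r -subr_ge0.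
  have -> : s - 1 + 2 / s * (s - 1) - s = (s - 2) / s.
    by field; rewrite gt_eqF.
  by rewrite divr_ge0; lra.
have -> : (D / 2 * tau)^-1 = 2 * s / D.
  by rewrite tauE; field; rewrite !gt_eqF.
rewrite invfM mulrA -mulrDl -[leRHS]mulrDl ler_pM2r ?invr_gt0//.
have : 2 * Lam * (1 - tau)^-1 <= 2 * Lam * (1 + 2 / s) by rewrite ler_wpM2l//; lra.
have -> : 2 * Lam * (1 + 2 / s) = 2 * Lam + 4 * s.
  by rewrite -s2; field; rewrite gt_eqF.
lra.
Qed.

(** The cost of the previous tuning is absorbed by the contribution of the low
    indices of the best arm: it has a factor [1 / 25] from [dlt] against
    [eps]. *)
Lemma sqrt_log_scales (Lam l dlt eps : R) : 0 < eps -> 5 * eps <= dlt ->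
  2 <= l -> 0 <= Lam <= 9 / 2 * l ->
  6 * Num.sqrt Lam / dlt ^+ 2 <= Num.sqrt l / eps ^+ 2.
Proof.
move=> e0 d5 l2 /andP[L0 Ll].
have e20 : 0 < eps ^+ 2 by rewrite exprn_gt0.
have d0 : 0 < dlt by lra.
have d2 : 25 * eps ^+ 2 <= dlt ^+ 2.
  have -> : 25 * eps ^+ 2 = (5 * eps) ^+ 2 by ring.
  by rewrite ler_sqr ?nnegrE//; lra.
have l0 : 0 <= Num.sqrt l by exact: sqrtr_ge0.
have sL : Num.sqrt Lam <= 4 * Num.sqrt l.
  have -> : 4 * Num.sqrt l = Num.sqrt (16 * l).
    by rewrite sqrtrM// (_ : 16 = 4 ^+ 2) ?sqrtr_sqr ?ger0_norm//; ring.
  by rewrite ler_sqrt; lra.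
rewrite ler_pdivrMr ?exprn_gt0// mulrAC ler_pdivlMr//.
nra.
Qed.

End tuning.

(** Bound on the expected number of draws of the worse arm. *)
Definition draws_bound (R : realType) (Delta : R) (T : nat) : R :=
  2 + 2 * ln (2 * T%:R * Delta ^+ 2) / (2 * Delta - 3 * eps_ Delta T) ^+ 2
  + (55 * Num.sqrt (ln (T%:R * eps_ Delta T ^+ 2)) + 58) / eps_ Delta T ^+ 2.

Section regret_bound.
Context {R : realType} {d : measure_display} {Omega : measurableType d}.
Variables (P : probability Omega R) (mu : arm -> R).
Variables (X : arm -> nat -> {RV P >-> R}) (b : arm) (Delta : R) (T : nat).
Variable tie : history R -> arm.
Hypothesis Delta_gt0 : 0 < Delta.
Hypothesis gap : mu (~~ b) - mu b = Delta.
Hypothesis X_bandit : gaussian_bandit mu X.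
Hypothesis T1 : (1 <= T)%N.

Local Notation eps := (eps_ Delta T).
Local Notation dlt := (2 * Delta - 3 * eps).
Local Notation y := (T%:R * eps ^+ 2).
Local Notation Lam := (ln (2 * T%:R * Delta ^+ 2)).

Lemma ucb_regret_le : 2 <= ln y ->
  (regret mu X (delta_ucb T Delta tie) T <= (Delta * draws_bound Delta T)%:E)%E.
Proof.
move=> l2.
have e0 := eps_gt0 T Delta_gt0; have e4 := eps_le T Delta_gt0.
have d5 : 5 * eps <= dlt by lra.
have /andP[Lam4 Laml] := log_scales Delta_gt0 l2.
have T0 : 0 < T%:R :> R by rewrite ltr0n.
have sL : 2 <= Num.sqrt Lam.
  have two : Num.sqrt (2 ^+ 2) = 2 :> R by rewrite sqrtr_sqr ger0_norm.
  by rewrite -[leLHS]two ler_sqrt; lra.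
pose tau := (Num.sqrt Lam)^-1.
have t01 : 0 < tau < 1.
  apply/andP; split; first by rewrite invr_gt0; lra.
  by rewrite invf_lt1; lra.
have [U [HU NU]] := bad_draws_mean tie Delta_gt0 gap X_bandit T1 t01 l2.
apply: le_trans (regret_le_mean Delta_gt0 gap HU NU) _.
rewrite lee_fin ler_pM2l// /draws_bound.
have d20 : 0 < dlt ^+ 2 by rewrite exprn_gt0//; lra.
have thr := tuned_threshold d20 Lam4 erefl; rewrite -/tau in thr.
have Lam0 : 0 <= Lam <= 9 / 2 * ln y by apply/andP; split; lra.
have six := sqrt_log_scales e0 d5 l2 Lam0.
have -> : T%:R * (54 * (Num.sqrt (ln y) + 1) / y) =
    (54 * Num.sqrt (ln y) + 54) / eps ^+ 2.
  by field; rewrite !gt_eqF.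
have combine (x z C E f V : R) : x + z <= C + E -> E <= f * V ->
    1 + (2 * V + (x + 1 + z) + 2 * V + (54 * f + 54) * V) <=
    2 + C + (55 * f + 58) * V by move=> *; lra.
exact: combine thr six.
Qed.

(** The leading terms coincide, as [dlt] is [2 * Delta] times
    [1 - 3 * eps / (2 * Delta)]; then [55 <= 30 * expR 1] and [58 <= 80]. *)
Lemma ucb_regret_le_stated : expR 1 ^+ 2 <= y ->
  (regret mu X (delta_ucb T Delta tie) T <=
     (Lam / (2 * Delta * (1 - 3 * eps / (2 * Delta)) ^+ 2)
      + Num.sqrt (pi * Lam) / (2 * Delta * (1 - 3 * eps / Delta) ^+ 2)
      + Delta * (30 * expR 1 * Num.sqrt (ln (eps ^+ 2 * T%:R)) / eps ^+ 2
                 + 80 / eps ^+ 2 + 2 / dlt ^+ 2)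
      + 5 * Delta)%:E)%E.
Proof.
move=> ye; have l2 : 2 <= ln y.
  have y0 : 0 < y by apply: lt_le_trans ye; rewrite exprn_gt0// expR_gt0.
  by rewrite -[leLHS]expRK ler_ln ?posrE ?expR_gt0// -[2]mulr1 expRM_natl.
apply: le_trans (ucb_regret_le l2) _; rewrite lee_fin /draws_bound.
have e0 := eps_gt0 T Delta_gt0; have e4 := eps_le T Delta_gt0.
have -> : eps ^+ 2 * T%:R = y by rewrite mulrC.
have -> : Lam / (2 * Delta * (1 - 3 * eps / (2 * Delta)) ^+ 2) =
    Delta * (2 * Lam / dlt ^+ 2).
  field; rewrite !gt_eqF//; lra.
have s0 : 0 <= Num.sqrt (pi * Lam) / (2 * Delta * (1 - 3 * eps / Delta) ^+ 2).
  by rewrite divr_ge0 ?sqrtr_ge0// mulr_ge0 ?sqr_ge0// mulr_ge0// ltW.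
have e20 : 0 < (eps ^+ 2)^-1 by rewrite invr_gt0 exprn_gt0.
have d20 : 0 <= 2 / dlt ^+ 2 by rewrite divr_ge0 ?sqr_ge0.
have ebig : 55 * Num.sqrt (ln y) <= 30 * expR 1 * Num.sqrt (ln y).
  rewrite ler_wpM2r ?sqrtr_ge0//.
  by have := expR_ge1Dx (1 : R); lra.
have : (55 * Num.sqrt (ln y) + 58) / eps ^+ 2 <=
    30 * expR 1 * Num.sqrt (ln y) / eps ^+ 2 + 80 / eps ^+ 2.
  by rewrite -mulrDl ler_pM2r//; lra.
move=> /(ler_wpM2l (ltW Delta_gt0)).
have := mulr_ge0 (ltW Delta_gt0) d20.
rewrite !mulrDr; lra.
Qed.

End regret_bound.

(** * The worst case over the gap *)

Section worst_case.
Context {R : realType}.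
Variables (Delta : R) (T : nat).
Hypothesis Delta_gt0 : 0 < Delta.
Hypothesis T1 : (1 <= T)%N.

Local Notation eps := (eps_ Delta T).
Local Notation dlt := (2 * Delta - 3 * eps).
Local Notation y := (T%:R * eps ^+ 2).
Local Notation Lam := (ln (2 * T%:R * Delta ^+ 2)).

(** With [z] the 16th root of [T Delta ^+ 2], the logarithm [L] is at most
    [4 z ^+ 4] and its fourth root [beta] is at most [3 / 2 z]. All the terms
    are then bounded by polynomials in [z], and [Delta = z ^+ 8 / sqrt T], so
    the claim follows from [z >= 2]. *)
Lemma worst_case_bound : 328 < Delta * Num.sqrt T%:R ->
  2 <= ln y /\
  Delta * draws_bound Delta T <= 328 * Num.sqrt T%:R + 5 * Delta.
Proof.
set S := Num.sqrt T%:R; set w := Delta * S => w328.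
have T0 : 0 < T%:R :> R by rewrite ltr0n.
have S0 : 0 < S by rewrite sqrtr_gt0.
have S2 : S ^+ 2 = T%:R by rewrite sqr_sqrtr// ltW.
have w0 : 0 < w by lra.
pose z := Num.sqrt (Num.sqrt (Num.sqrt w)).
have z0 : 0 < z by rewrite !sqrtr_gt0.
have z8 : z ^+ 8 = w.
  rewrite (_ : 8%N = (2 * (2 * 2))%N)// !exprM !sqr_sqrtr ?sqrtr_ge0//.
  exact: ltW.
have uE : T%:R * Delta ^+ 2 = z ^+ 16.
  by rewrite (exprM z 8 2) z8 /w exprMn S2 mulrC.
have z2 : 2 <= z.
  have : 2 ^+ 8 <= z ^+ 8 by rewrite z8; lra.
  by rewrite ler_pXn2r ?nnegrE// ltW.
have L1 := log_scale_ge1 Delta T; have ze0 := zeta_gt0 Delta T.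
have ze8 := zeta_expn8 Delta T; have epsE := epsE Delta T.
have e0 := eps_gt0 T Delta_gt0; have e4 := eps_le T Delta_gt0.
set L := ln _ in L1 ze0 ze8 epsE; set zeta := L `^ _ in ze0 ze8 epsE.
have L4 : L <= 4 * z ^+ 4.
  have z4 : 0 < z ^+ 4 by rewrite exprn_gt0.
  have lnz := ln_le_subr1 z4; have /andP[_ ln2] := @ln2_bounds R.
  have z16 : 2 ^+ 16 <= z ^+ 16 by rewrite ler_pXn2r ?nnegrE// ltW.
  have e3 := @expR1_le3 R.
  have eu : expR 1 + z ^+ 16 <= 2 * z ^+ 16 by lra.
  have eu0 : 0 < expR 1 + z ^+ 16 by rewrite addr_gt0 ?expR_gt0// exprn_gt0.
  have : ln (expR 1 + z ^+ 16) <= ln (2 * z ^+ 16).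
    by rewrite ler_ln ?posrE// mulr_gt0// exprn_gt0.
  rewrite /L uE (_ : 16%N = (4 * 4)%N)// (exprM z 4 4) lnM ?posrE ?exprn_gt0//.
  rewrite (lnXn 4 z4); lra.
pose beta := zeta ^- 2.
have beta0 : 0 < beta by rewrite invr_gt0 exprn_gt0.
have beta4 : beta ^+ 4 = L by rewrite exprVn -exprM ze8 invrK.
have betaz : beta <= 3 / 2 * z.
  have : beta ^+ 4 <= (3 / 2 * z) ^+ 4.
    rewrite beta4 exprMn; have : 0 <= z ^+ 4 by rewrite exprn_ge0// ltW.
    lra.
  by rewrite ler_pXn2r ?nnegrE ?mulr_ge0 ?(ltW beta0) ?(ltW z0).
have eps2 : eps ^+ 2 = Delta ^+ 2 / (16 * beta).
  by rewrite epsE /beta; field; rewrite gt_eqF.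
have yE : y = z ^+ 16 / (16 * beta) by rewrite eps2 -uE mulrA.
have y9 : 9 <= y.
  rewrite yE ler_pdivlMr ?mulr_gt0//.
  have z15 : 2 ^+ 15 <= z ^+ 15 by rewrite ler_pXn2r ?nnegrE// ltW.
  rewrite exprS.
  have : 2 ^+ 15 * z <= z * z ^+ 15 by rewrite mulrC ler_pM2l.
  lra.
have y0 : 0 < y by lra.
have l2 : 2 <= ln y.
  by rewrite -[leLHS]expRK ler_ln ?posrE ?expR_gt0// (le_trans expR2_le9).
split => //; rewrite /draws_bound.
have lL : ln y <= L.
  have e0' := expR_gt0 (1 : R).
  have u0 : 0 < T%:R * Delta ^+ 2 by rewrite mulr_gt0 ?exprn_gt0.
  rewrite /L ler_ln ?posrE ?addr_gt0//.
  have : eps ^+ 2 <= Delta ^+ 2 by nra.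
  by move=> /(ler_wpM2l (ltW T0)); lra.
have /andP[Lam4 Laml] := log_scales Delta_gt0 l2.
have sl : Num.sqrt (ln y) <= 2 * z ^+ 2.
  have -> : 2 * z ^+ 2 = Num.sqrt (4 * z ^+ 4).
    rewrite (_ : 4 * z ^+ 4 = (2 * z ^+ 2) ^+ 2); last by ring.
    by rewrite sqrtr_sqr ger0_norm// mulr_ge0// sqr_ge0.
  by rewrite ler_sqrt; lra.
have e20 : 0 < eps ^+ 2 by rewrite exprn_gt0.
have d2 : 25 * eps ^+ 2 <= dlt ^+ 2.
  have -> : 25 * eps ^+ 2 = (5 * eps) ^+ 2 by ring.
  by rewrite ler_sqr ?nnegrE//; lra.
have lead : 2 * Lam / dlt ^+ 2 <= (36 / 25 * z ^+ 4) / eps ^+ 2.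
  apply: (@le_trans _ _ ((36 * z ^+ 4) / (25 * eps ^+ 2))).
    apply: ler_pM; rewrite ?invr_ge0 ?sqr_ge0//; try lra.
    by rewrite lef_pV2 ?posrE; lra.
  by rewrite le_eqVlt; apply/orP; left; apply/eqP; field; rewrite gt_eqF.
have tot : 2 * Lam / dlt ^+ 2 + (55 * Num.sqrt (ln y) + 58) / eps ^+ 2 <=
    (36 / 25 * z ^+ 4 + 110 * z ^+ 2 + 58) / eps ^+ 2.
  have : (55 * Num.sqrt (ln y) + 58) / eps ^+ 2 <=
      (110 * z ^+ 2 + 58) / eps ^+ 2 by rewrite ler_pM2r ?invr_gt0//; lra.
  rewrite -[36 / 25 * _ + _ + _]addrA [leRHS]mulrDl; lra.
have main :
    Delta * ((36 / 25 * z ^+ 4 + 110 * z ^+ 2 + 58) / eps ^+ 2) <= 328 * S.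
  have -> : Delta * ((36 / 25 * z ^+ 4 + 110 * z ^+ 2 + 58) / eps ^+ 2) =
      16 * beta * (36 / 25 * z ^+ 4 + 110 * z ^+ 2 + 58) * S / w.
    by rewrite eps2 /w; field; rewrite !gt_eqF.
  rewrite ler_pdivrMr// -z8 [leRHS]mulrAC ler_pM2r//.
  have h3 : 8 <= z ^+ 3.
    by rewrite (_ : 8 = 2 ^+ 3) ?ler_pXn2r ?nnegrE ?(ltW z0)//; ring.
  have h5 : 32 <= z ^+ 5.
    by rewrite (_ : 32 = 2 ^+ 5) ?ler_pXn2r ?nnegrE ?(ltW z0)//; ring.
  have h7 : 128 <= z ^+ 7.
    by rewrite (_ : 128 = 2 ^+ 7) ?ler_pXn2r ?nnegrE ?(ltW z0)//; ring.
  have g5 : 8 * z ^+ 5 <= z ^+ 8.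
    by rewrite (exprD z 3 5) ler_wpM2r// exprn_ge0// ltW.
  have g3 : 32 * z ^+ 3 <= z ^+ 8.
    by rewrite (exprD z 5 3) ler_wpM2r// exprn_ge0// ltW.
  have g1 : 128 * z <= z ^+ 8 by rewrite (exprD z 7 1) expr1 ler_wpM2r// ltW.
  apply: (@le_trans _ _ (24 * z * (36 / 25 * z ^+ 4 + 110 * z ^+ 2 + 58))).
    apply: ler_wpM2r; last by lra.
    by rewrite !addr_ge0// mulr_ge0// exprn_ge0// ltW.
  have -> : 24 * z * (36 / 25 * z ^+ 4 + 110 * z ^+ 2 + 58) =
    864 / 25 * z ^+ 5 + 2640 * z ^+ 3 + 1392 * z by ring.
  lra.
have := ler_wpM2l (ltW Delta_gt0) tot; rewrite -addrA mulrDr.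
lra.
Qed.

End worst_case.

(** * Asymptotics *)

Section limsup.
Context {R : realType}.

(** For [e > 0], the sequence [u] is eventually at most [l + e]. *)
Lemma limn_esup_le_lim (u : (\bar R)^nat) (v : R^nat) (l : R) :
  (\forall n \near \oo, (u n <= (v n)%:E)%E) -> v @ \oo --> l ->
  (limn_esup u <= l%:E)%E.
Proof.
move=> uv vl; apply/lee_addgt0Pr => e e0.
pose V : set nat := [set n | (u n <= (l + e)%:E)%E].
have VF : nbhs \oo V.
  move/cvgrPdist_le : vl => /(_ e e0) vl.
  near=> n; rewrite /V/=.
  apply: (@le_trans _ _ (v n)%:E); first by near: n.
  rewrite lee_fin.
  have : `|l - v n| <= e by near: n.
  by rewrite ler_distlC => /andP[].
apply: (@le_trans _ _ (ereal_sup (u @` V))).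
  by apply: ereal_inf_lbound; exists V.
by apply: ge_ereal_sup => _ [n Vn <-].
Unshelve. all: by end_near. Qed.

Lemma cvg_exprn (f : R^nat) (a : R) (k : nat) :
  f @ \oo --> a -> f n ^+ k @[n --> \oo] --> a ^+ k.
Proof.
move=> fa; apply: (cvg_comp f (fun x => x ^+ k) fa).
exact: exprn_continuous.
Qed.

Lemma cvg_decreasing_power (zeta L : R^nat) :
  (forall n, 0 < zeta n) -> (forall n, zeta n ^+ 8 = (L n)^-1) ->
  (forall M, \forall n \near \oo, M <= L n) -> zeta @ \oo --> 0.
Proof.
move=> z0 z8 Loo; apply/cvgrPdist_le => e e0.
near=> n.
rewrite sub0r normrN ger0_norm ?(ltW (z0 n))//.
have : zeta n ^+ 8 <= e ^+ 8.
  rewrite z8 invf_ple ?posrE ?exprn_gt0//.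
    by near: n; exact: Loo.
  by rewrite -invr_gt0 -z8 exprn_gt0.
by rewrite ler_pXn2r ?nnegrE ?(ltW e0) ?(ltW (z0 n)).
Unshelve. all: by end_near. Qed.

End limsup.

Section asymptotics.
Context {R : realType}.
Variable Delta : R.
Hypothesis Delta_gt0 : 0 < Delta.

Let L (n : nat) : R := ln (expR 1 + n%:R * Delta ^+ 2).
Let zeta (n : nat) : R := L n `^ (- (1 / 8)).
Let C0 : R := ln (expR 1 + Delta ^+ 2).

Lemma near_horizon_ge (M : R) :
  \forall n \near \oo, M <= (n : nat)%:R * Delta ^+ 2.
Proof.
have d2 : 0 < Delta ^+ 2 by rewrite exprn_gt0.
near=> n; rewrite -ler_pdivrMr//; near: n; exact: nbhs_infty_ger.
Unshelve. all: by end_near. Qed.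

Lemma near_log_scale_ge (M : R) : \forall n \near \oo, M <= L n.
Proof.
near=> n; have e0 := expR_gt0 (1 : R); have M0 := expR_gt0 M.
have : expR M <= n%:R * Delta ^+ 2 by near: n; exact: near_horizon_ge.
move=> MD; rewrite -[leLHS]expRK /L ler_ln ?posrE//; lra.
Unshelve. all: by end_near. Qed.

Lemma near_ln_ge (M : R) : \forall n \near \oo, M <= ln (n : nat)%:R :> R.
Proof.
near=> n; have Mn : expR M <= n%:R by near: n; exact: nbhs_infty_ger.
by rewrite -[leLHS]expRK ler_ln ?posrE ?expR_gt0// (lt_le_trans (expR_gt0 M)).
Unshelve. all: by end_near. Qed.

Lemma cvg_zeta : zeta @ \oo --> 0.
Proof.
apply: (cvg_decreasing_power (L := L)); last exact: near_log_scale_ge.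
- by move=> n; exact: zeta_gt0.
- by move=> n; exact: zeta_expn8.
Qed.

Lemma cvg_inv_ln : (ln n%:R)^-1 @[n --> \oo] --> (0 : R).
Proof.
apply/cvgrPdist_le => e e0; near=> n.
have ln0 : e^-1 <= ln (n%:R : R) by near: n; exact: near_ln_ge.
have ln1 : 0 < ln (n%:R : R) by rewrite (lt_le_trans _ ln0)// invr_gt0.
by rewrite sub0r normrN ger0_norm ?invr_ge0 ?(ltW ln1)// invf_ple ?posrE.
Unshelve. all: by end_near. Qed.

(** Limit shape of the bound. With [z = L ^ (- 1 / 8)], the powers of [z] carry
    all the logarithms: [L * z ^+ 8 = 1], [L * z ^+ 4 = sqrt L] and
    [eps = Delta * z / 4]. *)
Definition rate (z : R) : R :=
  Delta * (2 * z ^+ 8 + 2 * (1 + z ^+ 8) * (2 * Delta - 3 * Delta / 4 * z) ^- 2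
           + (880 * z ^+ 2 + 928 * z ^+ 6) * Delta ^- 2).

Lemma rate_ge0 (z : R) : 0 <= z -> 0 <= rate z.
Proof.
move=> z0; have z2 := exprn_ge0 2 z0; have z6 := exprn_ge0 6 z0.
have z8 := exprn_ge0 8 z0.
have sqrV (x : R) : 0 <= x ^- 2 by rewrite invr_ge0 sqr_ge0.
have aux (a c e f g : R) : 0 <= a -> 0 <= c -> 0 <= e -> 0 <= f -> 0 <= g ->
    0 <= 2 * a + 2 * (1 + a) * c + (880 * e + 928 * f) * g.
  move=> a0 c0 e0 f0 g0.
  have ac : 0 <= (1 + a) * c by apply: mulr_ge0; [lra|exact: c0].
  have efg : 0 <= (880 * e + 928 * f) * g by apply: mulr_ge0; [lra|exact: g0].
  lra.
by rewrite /rate; apply: mulr_ge0; [exact: ltW|exact: aux].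
Qed.

Lemma cvg_rate : (1 + C0 * (ln n%:R)^-1) * rate (zeta n) @[n --> \oo] -->
  (2 * Delta)^-1.
Proof.
have -> : (2 * Delta)^-1 = (1 + C0 * 0) * rate 0.
  by rewrite /rate; field; rewrite gt_eqF.
have cz k : zeta n ^+ k @[n --> \oo] --> (0 : R) ^+ k.
  exact/cvg_exprn/cvg_zeta.
have cc (c : R) : (fun=> c) @ \oo --> c by move=> ?; exact: cvg_cst.
apply: cvgM.
  by apply: cvgD => //; apply: cvgM => //; exact: cvg_inv_ln.
apply: cvgM => //; apply: cvgD; [apply: cvgD|].
- exact: cvgM.
- apply: cvgM; first by apply: cvgM => //; exact: cvgD.
  have -> : (2 * Delta - 3 * Delta / 4 * 0) ^- 2 =
    ((2 * Delta - 3 * Delta / 4 * 0) ^+ 2)^-1 by [].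
  apply: cvgV; first by rewrite mulr0 subr0 sqrf_eq0 gt_eqF// mulr_gt0.
  apply: cvg_exprn; apply: cvgB => //; apply: cvgM => //.
  exact: cvg_zeta.
- by apply: cvgM => //; apply: cvgD; exact: cvgM.
Qed.

(** [Delta * draws_bound Delta n] is at most [L n * rate (zeta n)], and
    [L n <= ln n + C0]. *)
Lemma draws_bound_le_rate (n : nat) (eps := eps_ Delta n) : (2 <= n)%N ->
  2 <= ln (n%:R * eps ^+ 2) ->
  Delta * draws_bound Delta n * (ln n%:R)^-1 <=
  (1 + C0 * (ln n%:R)^-1) * rate (zeta n).
Proof.
move=> n2 l2.
have n0 : 0 < n%:R :> R by rewrite ltr0n (leq_trans _ n2).
have n1 : 1 <= n%:R :> R by rewrite ler1n (leq_trans _ n2).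
have ln0 : 0 < ln (n%:R : R) by rewrite ln_gt0// ltr1n.
have d20 : 0 < Delta ^+ 2 by rewrite exprn_gt0.
have e1 := expR_gt0 (1 : R).
have u0 : 0 < n%:R * Delta ^+ 2 by rewrite mulr_gt0.
have L1 : 1 <= L n := log_scale_ge1 Delta n.
have z0 : 0 < zeta n := zeta_gt0 Delta n.
have z1 : zeta n <= 1 := zeta_le1 Delta n.
have z8 : zeta n ^+ 8 = (L n)^-1 := zeta_expn8 Delta n.
have epsE : eps = Delta / 4 * zeta n by [].
have e0 := eps_gt0 n Delta_gt0; have e4 := eps_le n Delta_gt0.
rewrite -/eps in e0 e4.
have Ln : L n <= ln n%:R + C0.
  rewrite -lnM ?posrE ?addr_gt0// /L ler_ln ?posrE ?addr_gt0 ?mulr_gt0 ?addr_gt0//.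
  by rewrite mulrDr lerD2r ler_peMl// ltW.
have Lam1 : ln (2 * n%:R * Delta ^+ 2) <= 1 + L n.
  rewrite -mulrA lnM ?posrE//; have /andP[_ ln2] := @ln2_bounds R.
  have : ln (n%:R * Delta ^+ 2) <= L n.
    by rewrite ler_ln ?posrE ?addr_gt0// lerDr ltW.
  lra.
have y0 : 0 < n%:R * eps ^+ 2 by rewrite mulr_gt0 ?exprn_gt0.
have lL : ln (n%:R * eps ^+ 2) <= L n.
  rewrite /L ler_ln ?posrE ?addr_gt0//.
  have : eps ^+ 2 <= Delta ^+ 2 by nra.
  by move=> /(ler_wpM2l (ltW n0)); lra.
have Lz : L n = (zeta n ^- 4) ^+ 2 by rewrite exprVn -exprM z8 invrK.
have sl : Num.sqrt (ln (n%:R * eps ^+ 2)) <= zeta n ^- 4.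
  have z40 : 0 <= zeta n ^- 4 by rewrite invr_ge0 exprn_ge0// ltW.
  by rewrite -[leRHS]ger0_norm// -sqrtr_sqr -Lz ler_sqrt//; lra.
have d0 : 0 < 2 * Delta - 3 * eps by lra.
have dE : 2 * Delta - 3 * eps = 2 * Delta - 3 * Delta / 4 * zeta n.
  by rewrite epsE; field.
have step : Delta * draws_bound Delta n <= L n * rate (zeta n).
  rewrite /draws_bound -/eps.
  have -> : L n * rate (zeta n) = Delta * (2
      + 2 * (1 + L n) / (2 * Delta - 3 * eps) ^+ 2
      + (55 * zeta n ^- 4 + 58) / eps ^+ 2).
    rewrite /rate -dE; set D := (2 * Delta - 3 * eps) ^- 2.
    have Lz8 : L n * zeta n ^+ 8 = 1 by rewrite z8 divff// gt_eqF; lra.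
    have Lz2 : L n * zeta n ^+ 2 = zeta n ^- 4 * zeta n ^- 2.
      by rewrite Lz; field; rewrite gt_eqF.
    have Lz6 : L n * zeta n ^+ 6 = zeta n ^- 2.
      by rewrite Lz; field; rewrite gt_eqF.
    have -> : eps ^- 2 = 16 * zeta n ^- 2 * Delta ^- 2.
      by rewrite epsE; field; rewrite !gt_eqF.
    transitivity (Delta * (2 * (L n * zeta n ^+ 8)
      + 2 * (L n + L n * zeta n ^+ 8) * D
      + (880 * (L n * zeta n ^+ 2) + 928 * (L n * zeta n ^+ 6)) * Delta ^- 2)).
      by ring.
    by rewrite Lz8 Lz2 Lz6 /D; ring.
  rewrite ler_pM2l// lerD//; first rewrite lerD//.
    by rewrite ler_pM2r ?invr_gt0 ?exprn_gt0//; lra.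
  by rewrite ler_pM2r ?invr_gt0 ?exprn_gt0//; lra.
have rate0 : 0 <= rate (zeta n) by apply: rate_ge0; exact: ltW.
apply: (@le_trans _ _ (L n * rate (zeta n) * (ln n%:R)^-1)).
  by rewrite ler_wpM2r// invr_ge0 ltW.
by rewrite mulrAC ler_wpM2r// ler_pdivrMr// mulrDl mul1r divfK ?gt_eqF.
Qed.

End asymptotics.

(** * The regret bounds *)

Theorem theorem7 (R : realType) (d : measure_display)
    (Omega : measurableType d) (P : probability Omega R)
    (Delta : R) (mu : arm -> R) (X : arm -> nat -> {RV P >-> R})
    (tie : nat -> history R -> arm)
    (Delta_gt0 : 0 < Delta) (mu_gap : hyp_gap Delta mu)
    (X_bandit : gaussian_bandit mu X)
    (tie_measurable : forall T, measurable_strategy (tie T)) :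
  let Reg := fun T : nat => regret mu X (delta_ucb T Delta (tie T)) T in
  (forall T : nat, (1 <= T)%N ->
     let eps := eps_ Delta T in
     T%:R * (2 * Delta - 3 * eps) ^+ 2 >= 2 ->
     T%:R * eps ^+ 2 >= expR 1 ^+ 2 ->
     (Reg T <=
        (ln (2 * T%:R * Delta ^+ 2)
           / (2 * Delta * (1 - 3 * eps / (2 * Delta)) ^+ 2)
         + Num.sqrt (pi * ln (2 * T%:R * Delta ^+ 2))
             / (2 * Delta * (1 - 3 * eps / Delta) ^+ 2)
         + Delta * (30 * expR 1 * Num.sqrt (ln (eps ^+ 2 * T%:R)) / eps ^+ 2
                    + 80 / eps ^+ 2
                    + 2 / (2 * Delta - 3 * eps) ^+ 2)
         + 5 * Delta)%:E)%E)
  /\ (limn_esup (fun T : nat => Reg T * ((ln T%:R)^-1)%:E)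
        <= ((2 * Delta)^-1)%:E)%E
  /\ (forall T : nat, (1 <= T)%N ->
        (Reg T <= (328 * Num.sqrt T%:R + 5 * Delta)%:E)%E).
Proof.
have [b gap] : exists b, mu (~~ b) - mu b = Delta.
  have [h|h] := leP (mu true) (mu false).
    by exists true; rewrite -mu_gap ger0_norm// subr_ge0.
  by exists false; rewrite -mu_gap ltr0_norm ?opprB// subr_lt0.
move=> Reg; split; [|split].
- move=> T T1 eps _.
  exact: (ucb_regret_le_stated (tie T) Delta_gt0 gap X_bandit T1).
- apply: (limn_esup_le_lim _ (cvg_rate Delta_gt0)).
  near=> T.
  have T2 : (2 <= T)%N by near: T; exact: nbhs_infty_ge.
  have T1 : (1 <= T)%N by exact: ltnW.
  (* any constant above 328 makes the inequality strict *)
  have big : (2 * 328) ^+ 2 <= T%:R * Delta ^+ 2.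
    by near: T; exact: near_horizon_ge.
  have w328 : 328 < Delta * Num.sqrt T%:R.
    rewrite mulrC -[Delta in _ * Delta]ger0_norm ?(ltW Delta_gt0)// -sqrtr_sqr.
    rewrite -sqrtrM ?ler0n// (@lt_le_trans _ _ (2 * 328))//; first by lra.
    have two : Num.sqrt ((2 * 328) ^+ 2) = 2 * 328 :> R.
      by rewrite sqrtr_sqr ger0_norm//; lra.
    by rewrite -[leLHS]two ler_sqrt// (le_trans _ big)// sqr_ge0.
  have [l2 _] := worst_case_bound Delta_gt0 T1 w328.
  have := draws_bound_le_rate Delta_gt0 T2 l2; rewrite -lee_fin; apply: le_trans.
  rewrite EFinM lee_wpmul2r//.
    by rewrite lee_fin invr_ge0 ln_ge0// ler1n.
  exact: (ucb_regret_le (tie T) Delta_gt0 gap X_bandit T1 l2).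
- move=> T T1; have T0 : 0 <= T%:R :> R by exact: ler0n.
  have [w|w] := leP (Delta * Num.sqrt T%:R) 328.
    apply: le_trans (regret_le_horizon X Delta_gt0 gap _ T) _; rewrite lee_fin.
    rewrite -{1}(sqr_sqrtr T0) expr2 mulrA.
    have : Delta * Num.sqrt T%:R * Num.sqrt T%:R <= 328 * Num.sqrt T%:R.
      by rewrite ler_wpM2r// sqrtr_ge0.
    lra.
  have [l2 bound] := worst_case_bound Delta_gt0 T1 w.
  apply: le_trans (ucb_regret_le (tie T) Delta_gt0 gap X_bandit T1 l2) _.
  by rewrite lee_fin.
Unshelve. all: by end_near. Qed.
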